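(* For a weak bimonoid $B$ in a Cauchy complete braided monoidal category $(\mathcal M,\otimes,K,c)$, the induced weak bimonad $\bullet\otimes B$ on $\mathcal M$ is a weak right Hopf monad if and only if $B$ is a weak Hopf monoid.
   Context: Monoidal categories need not be strict, but coherence isomorphisms are suppressed. An object also denotes its identity morphism. Cauchy complete means that idempotent morphisms split. $B^n$ denotes $B^{\otimes n}$. A weak bimonoid in a braided monoidal category is an object $B$ with a monoid structure $(\mu,\eta)$ and a comonoid structure $(\delta,\varepsilon)$ such that (b) $\delta\mu=(\mu\otimes\mu)(B\otimes c_{B,B}\otimes B)(\delta\otimes\delta)$; (v) $\varepsilon\mu^2=(\varepsilon\otimes\varepsilon)(\mu\otimes\mu)(B\otimes\delta\otimes B)=(\varepsilon\otimes\varepsilon)(\mu\otimes\mu)(B\otimes c^{-1}_{B,B}\delta\otimes B)$ as morphisms $B^3\to K$, where $\mu^2$ is the iterated multiplication; (w) $(\delta\otimes B)\delta\eta=(B\otimes\mu\otimes B)(\delta\otimes\delta)(\eta\otimes\eta)=(B\otimes\mu c^{-1}_{B,B}\otimes B)(\delta\otimes\delta)(\eta\otimes\eta)$ as morphisms $K\to B^3$. Put $t=(B\otimes\varepsilon)(B\otimes\mu)(c_{B,B}\otimes B)(B\otimes\delta)(B\otimes\eta)$ and $r=(\varepsilon\otimes B)(\mu\otimes B)(B\otimes c_{B,B})(\delta\otimes B)(\eta\otimes B)$, both $B\to B$. With convolution $f\ast g=\mu(f\otimes g)\delta$, a weak Hopf monoid is a weak bimonoid $B$ for which there is a morphism $\nu:B\to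 B$ (the antipode) with $\nu\ast\mathrm{id}_B=t$, $\mathrm{id}_B\ast\nu=r$ and $\nu\ast\mathrm{id}_B\ast\nu=\nu$. Weak bimonad of a weak bimonoid: $T=\bullet\otimes B$ is a monad with multiplication $m=\bullet\otimes\mu$ and unit $u=\bullet\otimes\eta$, and is opmonoidal with $\tau_{X,Y}=(X\otimes c_{Y,B}\otimes B)(X\otimes Y\otimes\delta):T(X\otimes Y)\to TX\otimes TY$, $\tau_0=\varepsilon:TK\to K$; this makes $T$ a weak bimonad (i.e. $\mathcal M^T$ becomes monoidal with separable Frobenius forgetful functor). Associated data for a weak bimonad $(T,m,u,\tau,\tau_0)$ on a Cauchy complete monoidal category. For $T$-algebras $(A,a),(A',a')$ let $E_{A,A'}=(a\otimes a')\tau_{A,A'}u_{A\otimes A'}$, and for three algebras $E^{(3)}_{A,A',A''}=(a\otimes a'\otimes a'')\tau^{(3)}_{A,A',A''}u_{A\otimes A'\otimes A''}$ with $\tau^{(3)}_{X,Y,Z}=(\tau_{X,Y}\otimes TZ)\tau_{X\otimes Y,Z}$. These are idempotent. The morphism $\sqcap=(TK\otimes\tau_0)(TK\otimes m_K)\tau_{K,TK}u_{TK}:TK\to TK$ is idempotent; choose a splitting $TK\xrightarrow{P}R\xrightarrow{I}TK$, $IP=\sqcap$, $PI=\mathrm{id}_R$. Then $R$ is a $T$-algebra with action $P\circ m_K\circ TI$, and a separable Frobenius monoid with $\mu_R=(R\otimes\tau_0I)E_{R,R}$, $\eta_R=Pu_K$, $\delta_R=E_{R,R}(R\otimes Pu_K)$,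 $\varepsilon_R=\tau_0I$. Each $T$-algebra $A$ is an $R$-bimodule with left action $\beta_A=(\tau_0I\otimes A)E_{R,A}:R\otimes A\to A$ and two-sided action $\varrho_A=(\tau_0I\otimes A\otimes\tau_0I)E^{(3)}_{R,A,R}:R\otimes A\otimes R\to A$. Let $\lambda_X=m_X\circ T\varrho_{TX}\circ T(R\otimes u_X\otimes R):T(R\otimes X\otimes R)\to TX$ and $$F_{X,Y}=\lambda_{TX\otimes Y}\circ T(R\otimes\beta_{TX}\otimes Y\otimes R)\circ T(\delta_R\eta_R\otimes TX\otimes Y\otimes\eta_R):T(TX\otimes Y)\to T(TX\otimes Y),$$ an idempotent. Let $\mathsf{can}_{X,Y}=(m_X\otimes TY)\circ\tau_{TX,Y}:T(TX\otimes Y)\to TX\otimes TY$. $T$ is a weak right Hopf monad if there is a natural transformation $\chi_{X,Y}:TX\otimes TY\to T(TX\otimes Y)$ such that $\chi_{X,Y}E_{TX,TY}=\chi_{X,Y}=F_{X,Y}\chi_{X,Y}$, $\chi_{X,Y}\mathsf{can}_{X,Y}=F_{X,Y}$ and $\mathsf{can}_{X,Y}\chi_{X,Y}=E_{TX,TY}$ for all $X,Y$. *)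

(* Defs.v *)
From mathcomp Require Import ssreflect.

Set Implicit Arguments.
Unset Strict Implicit.
Unset Printing Implicit Defensive.

Declare Scope cat_scope.
Delimit Scope cat_scope with cat.
Local Open Scope cat_scope.

Reserved Notation "X ~> Y" (at level 90, right associativity).
Reserved Notation "g ∘ f" (at level 50, left associativity).
Reserved Notation "X ⊗ Y" (at level 40, left associativity).
Reserved Notation "f ⊠ g" (at level 40, left associativity).
Reserved Notation "X ◁ f" (at level 40, left associativity).
Reserved Notation "f ▷ X" (at level 40, left associativity).

Record category := Category {
  ob :> Type;
  hom : ob -> ob -> Type;
  idm : forall X, hom X X;
  comp : forall X Y Z, hom Y Z -> hom X Y -> hom X Z;
  comp1m : forall X Y (f : hom X Y), comp (idm Y) f = f;
  compm1 : forall X Y (f : hom X Y), comp f (idm X) = f;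
  compA : forall X Y Z W (h : hom Z W) (g : hom Y Z) (f : hom X Y),
    comp h (comp g f) = comp (comp h g) f
}.
Arguments hom {c} X Y.
Arguments idm {c} X.
Arguments comp {c X Y Z} g f.

Notation "X ~> Y" := (hom X Y) : type_scope.
Notation "g ∘ f" := (comp g f) : cat_scope.

Record splitting (C : category) (X : C) (e : X ~> X) := Splitting {
  split_ob : C;
  split_proj : X ~> split_ob;
  split_incl : split_ob ~> X;
  split_inclK : split_incl ∘ split_proj = e;
  split_projK : split_proj ∘ split_incl = idm split_ob
}.

Definition cauchy_complete (C : category) : Prop :=
  forall (X : C) (e : X ~> X), e ∘ e = e -> inhabited (splitting e).

Record monoidal_category := MonoidalCategory {
  mcat :> category;
  tens : mcat -> mcat -> mcat;
  tensm : forall X X' Y Y' : mcat,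
    (X ~> X') -> (Y ~> Y') -> (tens X Y ~> tens X' Y');
  munit : mcat;
  assoc : forall X Y Z : mcat, tens (tens X Y) Z ~> tens X (tens Y Z);
  associ : forall X Y Z : mcat, tens X (tens Y Z) ~> tens (tens X Y) Z;
  lunit : forall X : mcat, tens munit X ~> X;
  luniti : forall X : mcat, X ~> tens munit X;
  runit : forall X : mcat, tens X munit ~> X;
  runiti : forall X : mcat, X ~> tens X munit;
  tensm1 : forall X Y : mcat, tensm (idm X) (idm Y) = idm (tens X Y);
  tensmM : forall (X X' X'' Y Y' Y'' : mcat) (f' : X' ~> X'') (f : X ~> X')
      (g' : Y' ~> Y'') (g : Y ~> Y'),
    tensm (f' ∘ f) (g' ∘ g) = tensm f' g' ∘ tensm f g;
  assoc_nat : forall (X X' Y Y' Z Z' : mcat)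
      (f : X ~> X') (g : Y ~> Y') (h : Z ~> Z'),
    assoc X' Y' Z' ∘ tensm (tensm f g) h = tensm f (tensm g h) ∘ assoc X Y Z;
  lunit_nat : forall (X X' : mcat) (f : X ~> X'),
    lunit X' ∘ tensm (idm munit) f = f ∘ lunit X;
  runit_nat : forall (X X' : mcat) (f : X ~> X'),
    runit X' ∘ tensm f (idm munit) = f ∘ runit X;
  assocK : forall X Y Z, associ X Y Z ∘ assoc X Y Z = idm _;
  associK : forall X Y Z, assoc X Y Z ∘ associ X Y Z = idm _;
  lunitK : forall X, luniti X ∘ lunit X = idm _;
  lunitiK : forall X, lunit X ∘ luniti X = idm _;
  runitK : forall X, runiti X ∘ runit X = idm _;
  runitiK : forall X, runit X ∘ runiti X = idm _;
  pentagon : forall X Y Z W : mcat,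
    assoc X Y (tens Z W) ∘ assoc (tens X Y) Z W =
    tensm (idm X) (assoc Y Z W) ∘ assoc X (tens Y Z) W
      ∘ tensm (assoc X Y Z) (idm W);
  triangle : forall X Y : mcat,
    tensm (idm X) (lunit Y) ∘ assoc X munit Y = tensm (runit X) (idm Y)
}.
Arguments tens {m} X Y.
Arguments tensm {m X X' Y Y'} f g.
Arguments munit {m}.
Arguments assoc {m} X Y Z.
Arguments associ {m} X Y Z.
Arguments lunit {m} X.
Arguments luniti {m} X.
Arguments runit {m} X.
Arguments runiti {m} X.

Notation "X ⊗ Y" := (tens X Y) : cat_scope.
Notation "f ⊠ g" := (tensm f g) : cat_scope.
Notation "X ◁ f" := (tensm (idm X) f) : cat_scope.
Notation "f ▷ X" := (tensm f (idm X)) : cat_scope.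

Record braided_category := BraidedCategory {
  bmcat :> monoidal_category;
  braid : forall X Y : bmcat, X ⊗ Y ~> Y ⊗ X;
  braidi : forall X Y : bmcat, Y ⊗ X ~> X ⊗ Y;
  braidK : forall X Y, braidi X Y ∘ braid X Y = idm _;
  braidiK : forall X Y, braid X Y ∘ braidi X Y = idm _;
  braid_nat : forall (X X' Y Y' : bmcat) (f : X ~> X') (g : Y ~> Y'),
    braid X' Y' ∘ (f ⊠ g) = (g ⊠ f) ∘ braid X Y;
  hexagon_r : forall X Y Z : bmcat,
    assoc Y Z X ∘ braid X (Y ⊗ Z) ∘ assoc X Y Z =
    (Y ◁ braid X Z) ∘ assoc Y X Z ∘ (braid X Y ▷ Z);
  hexagon_l : forall X Y Z : bmcat,
    associ Z X Y ∘ braid (X ⊗ Y) Z ∘ associ X Y Z =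
    (braid X Z ▷ Y) ∘ associ X Z Y ∘ (X ◁ braid Y Z)
}.
Arguments braid {b} X Y.
Arguments braidi {b} X Y.

(* Re-bracketed versions of [X ⊗ f ⊗ W]. *)
Section Inner.
Context (M : monoidal_category).

Definition inner (X Y Z Y' Z' W : M) (f : Y ⊗ Z ~> Y' ⊗ Z') :
    (X ⊗ Y) ⊗ (Z ⊗ W) ~> (X ⊗ Y') ⊗ (Z' ⊗ W) :=
  associ X Y' (Z' ⊗ W)
    ∘ (X ◁ (assoc Y' Z' W ∘ (f ▷ W) ∘ associ Y Z W))
    ∘ assoc X Y (Z ⊗ W).

Definition inner_split (X Y Z Z' W : M) (f : Y ~> Z ⊗ Z') :
    (X ⊗ Y) ⊗ W ~> (X ⊗ Z) ⊗ (Z' ⊗ W) :=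
  assoc (X ⊗ Z) Z' W ∘ ((associ X Z Z' ∘ (X ◁ f)) ▷ W).

Definition inner_merge (X Y Y' Z W : M) (f : Y ⊗ Y' ~> Z) :
    (X ⊗ Y) ⊗ (Y' ⊗ W) ~> (X ⊗ Z) ⊗ W :=
  (((X ◁ f) ∘ assoc X Y Y') ▷ W) ∘ associ (X ⊗ Y) Y' W.

End Inner.

Record monoid_comonoid (M : monoidal_category) := MonoidComonoid {
  carrier :> M;
  mu : carrier ⊗ carrier ~> carrier;
  eta : munit ~> carrier;
  delta : carrier ~> carrier ⊗ carrier;
  eps : carrier ~> munit;
  muA : mu ∘ (mu ▷ carrier) = mu ∘ (carrier ◁ mu) ∘ assoc _ _ _;
  mu1m : mu ∘ (eta ▷ carrier) = lunit carrier;
  mum1 : mu ∘ (carrier ◁ eta) = runit carrier;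
  deltaA : assoc _ _ _ ∘ (delta ▷ carrier) ∘ delta = (carrier ◁ delta) ∘ delta;
  delta1m : (eps ▷ carrier) ∘ delta = luniti carrier;
  deltam1 : (carrier ◁ eps) ∘ delta = runiti carrier
}.
Arguments mu {M} m.
Arguments eta {M} m.
Arguments delta {M} m.
Arguments eps {M} m.

(* [K ⊗ K] is identified with [K] and [B^3] is bracketed as [(B ⊗ B) ⊗ B]. *)
Record weak_bimonoid (M : braided_category) := WeakBimonoid {
  wbm :> monoid_comonoid M;
  delta_mu : delta wbm ∘ mu wbm =
    (mu wbm ⊠ mu wbm) ∘ inner _ _ (braid wbm wbm) ∘ (delta wbm ⊠ delta wbm);
  eps_mu2 : eps wbm ∘ mu wbm ∘ (mu wbm ▷ wbm) =
    lunit munit ∘ (eps wbm ⊠ eps wbm) ∘ (mu wbm ⊠ mu wbm)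
      ∘ inner_split wbm wbm (delta wbm);
  eps_mu2i : eps wbm ∘ mu wbm ∘ (mu wbm ▷ wbm) =
    lunit munit ∘ (eps wbm ⊠ eps wbm) ∘ (mu wbm ⊠ mu wbm)
      ∘ inner_split wbm wbm (braidi wbm wbm ∘ delta wbm);
  delta2_eta : (delta wbm ▷ wbm) ∘ delta wbm ∘ eta wbm =
    inner_merge wbm wbm (mu wbm) ∘ (delta wbm ⊠ delta wbm)
      ∘ (eta wbm ⊠ eta wbm) ∘ luniti munit;
  delta2_etai : (delta wbm ▷ wbm) ∘ delta wbm ∘ eta wbm =
    inner_merge wbm wbm (mu wbm ∘ braidi wbm wbm) ∘ (delta wbm ⊠ delta wbm)
      ∘ (eta wbm ⊠ eta wbm) ∘ luniti munit
}.

Section WeakHopfMonoid.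
Context (M : braided_category) (B : weak_bimonoid M).

Definition target_map : B ~> B :=
  runit B ∘ (B ◁ eps B) ∘ (B ◁ mu B) ∘ assoc B B B ∘ (braid B B ▷ B)
    ∘ associ B B B ∘ (B ◁ delta B) ∘ (B ◁ eta B) ∘ runiti B.

Definition source_map : B ~> B :=
  lunit B ∘ (eps B ▷ B) ∘ (mu B ▷ B) ∘ associ B B B ∘ (B ◁ braid B B)
    ∘ assoc B B B ∘ (delta B ▷ B) ∘ (eta B ▷ B) ∘ luniti B.

Definition convolution (f g : B ~> B) : B ~> B := mu B ∘ (f ⊠ g) ∘ delta B.

Definition weak_hopf_monoid : Prop :=
  exists nu : B ~> B,
    convolution nu (idm B) = target_map /\
    convolution (idm B) nu = source_map /\
    convolution (convolution nu (idm B)) nu = nu.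

End WeakHopfMonoid.

(* The data [(T, m, u, tau, tau0)] underlying a weak bimonad: a monad whose
   underlying functor is opmonoidal. The compatibility making the category of
   T-algebras monoidal, with separable Frobenius forgetful functor, is not a
   field: it is a theorem for [- ⊗ B], and no formula below depends on it. *)
Record opmonoidal_functor_monad (M : monoidal_category) := OpmonoidalFunctorMonad {
  To :> M -> M;
  Tm : forall X Y : M, (X ~> Y) -> (To X ~> To Y);
  mT : forall X : M, To (To X) ~> To X;
  uT : forall X : M, X ~> To X;
  tau : forall X Y : M, To (X ⊗ Y) ~> To X ⊗ To Y;
  tau0 : To munit ~> munit;
  Tm1 : forall X : M, Tm (idm X) = idm (To X);
  TmM : forall (X Y Z : M) (g : Y ~> Z) (f : X ~> Y), Tm (g ∘ f) = Tm g ∘ Tm f;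
  mT_nat : forall (X Y : M) (f : X ~> Y), mT Y ∘ Tm (Tm f) = Tm f ∘ mT X;
  uT_nat : forall (X Y : M) (f : X ~> Y), uT Y ∘ f = Tm f ∘ uT X;
  mTA : forall X : M, mT X ∘ mT (To X) = mT X ∘ Tm (mT X);
  mTu : forall X : M, mT X ∘ uT (To X) = idm (To X);
  mTTu : forall X : M, mT X ∘ Tm (uT X) = idm (To X);
  tau_nat : forall (X X' Y Y' : M) (f : X ~> X') (g : Y ~> Y'),
    tau X' Y' ∘ Tm (f ⊠ g) = (Tm f ⊠ Tm g) ∘ tau X Y;
  tauA : forall X Y Z : M,
    assoc _ _ _ ∘ (tau X Y ▷ To Z) ∘ tau (X ⊗ Y) Z =
    (To X ◁ tau Y Z) ∘ tau X (Y ⊗ Z) ∘ Tm (assoc X Y Z);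
  tau1m : forall X : M,
    lunit (To X) ∘ (tau0 ▷ To X) ∘ tau munit X = Tm (lunit X);
  taum1 : forall X : M,
    runit (To X) ∘ (To X ◁ tau0) ∘ tau X munit = Tm (runit X)
}.
Arguments Tm {M} o {X Y} f.
Arguments mT {M} o X.
Arguments uT {M} o X.
Arguments tau {M} o X Y.
Arguments tau0 {M} o.

(* A T-algebra enters the formulas below only through its action [T A ~> A]. *)
Section WeakRightHopfMonad.
Context (M : monoidal_category) (T : opmonoidal_functor_monad M).
Notation K := (@munit M).

Definition Eid (A A' : M) (a : T A ~> A) (a' : T A' ~> A') :
    A ⊗ A' ~> A ⊗ A' :=
  (a ⊠ a') ∘ tau T A A' ∘ uT T (A ⊗ A').

Definition tau3 (X Y Z : M) : T ((X ⊗ Y) ⊗ Z) ~> (T X ⊗ T Y) ⊗ T Z :=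
  (tau T X Y ▷ T Z) ∘ tau T (X ⊗ Y) Z.

Definition Eid3 (A A' A'' : M)
    (a : T A ~> A) (a' : T A' ~> A') (a'' : T A'' ~> A'') :
    (A ⊗ A') ⊗ A'' ~> (A ⊗ A') ⊗ A'' :=
  ((a ⊠ a') ⊠ a'') ∘ tau3 A A' A'' ∘ uT T ((A ⊗ A') ⊗ A'').

Definition sqcap : T K ~> T K :=
  runit (T K) ∘ (T K ◁ tau0 T) ∘ (T K ◁ mT T K) ∘ tau T K (T K)
    ∘ Tm T (luniti (T K)) ∘ uT T (T K).

Definition can (X Y : M) : T (T X ⊗ Y) ~> T X ⊗ T Y :=
  (mT T X ▷ T Y) ∘ tau T (T X) Y.

(* [S] is the chosen splitting [T K -> R -> T K] of [sqcap]. *)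
Section BaseMonoid.
Context (S : splitting sqcap).

Definition R : M := split_ob S.
Definition actR : T R ~> R := split_proj S ∘ mT T K ∘ Tm T (split_incl S).
Definition etaR : K ~> R := split_proj S ∘ uT T K.
Definition deltaR : R ~> R ⊗ R := Eid actR actR ∘ (R ◁ etaR) ∘ runiti R.
Definition epsR : R ~> K := tau0 T ∘ split_incl S.

Definition beta (A : M) (a : T A ~> A) : R ⊗ A ~> A :=
  lunit A ∘ (epsR ▷ A) ∘ Eid actR a.

Definition varrho (A : M) (a : T A ~> A) : (R ⊗ A) ⊗ R ~> A :=
  runit A ∘ (lunit A ▷ K) ∘ ((epsR ▷ A) ⊠ epsR) ∘ Eid3 actR a actR.

Definition lam (X : M) : T ((R ⊗ X) ⊗ R) ~> T X :=
  mT T X ∘ Tm T (varrho (mT T X)) ∘ Tm T ((R ◁ uT T X) ▷ R).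

Definition Fid (X Y : M) : T (T X ⊗ Y) ~> T (T X ⊗ Y) :=
  lam (T X ⊗ Y)
    ∘ Tm T ((R ◁ ((beta (mT T X) ▷ Y) ∘ associ R (T X) Y)) ▷ R)
    ∘ Tm T (assoc R R (T X ⊗ Y) ▷ R)
    ∘ Tm T (((deltaR ∘ etaR) ▷ (T X ⊗ Y)) ⊠ etaR)
    ∘ Tm T (runiti (K ⊗ (T X ⊗ Y)) ∘ luniti (T X ⊗ Y)).

End BaseMonoid.

Definition weak_right_hopf_monad : Prop :=
  exists (S : splitting sqcap)
         (chi : forall X Y : M, T X ⊗ T Y ~> T (T X ⊗ Y)),
    (forall (X X' Y Y' : M) (f : X ~> X') (g : Y ~> Y'),
       chi X' Y' ∘ (Tm T f ⊠ Tm T g) = Tm T (Tm T f ⊠ g) ∘ chi X Y) /\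
    (forall X Y : M,
       chi X Y ∘ Eid (mT T X) (mT T Y) = chi X Y /\
       Fid S X Y ∘ chi X Y = chi X Y /\
       chi X Y ∘ can X Y = Fid S X Y /\
       can X Y ∘ chi X Y = Eid (mT T X) (mT T Y)).

End WeakRightHopfMonad.


Lemma comp_l (C : category) (X Y Z W : C) (g : Y ~> Z) (f : X ~> Y) (k : X ~> Z) :
  g ∘ f = k -> forall h : W ~> X, g ∘ (f ∘ h) = k ∘ h.
Proof. by move=> <- h; rewrite compA. Qed.

Lemma comp_epi (C : category) (X Y Z : C) (i : X ~> Y) (j : Y ~> X) (f g : Y ~> Z) :
  i ∘ j = idm Y -> f ∘ i = g ∘ i -> f = g.
Proof. by move=> ij fg; rewrite -(compm1 f) -ij compA fg -compA ij compm1. Qed.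

Lemma comp_mono (C : category) (X Y Z : C) (i : X ~> Y) (j : Y ~> X) (f g : Z ~> X) :
  j ∘ i = idm X -> i ∘ f = i ∘ g -> f = g.
Proof. by move=> ji fg; rewrite -(comp1m f) -ji -compA fg compA ji comp1m. Qed.

Section MonoidalFacts.
Context (M : monoidal_category).
Implicit Types X Y Z W : M.
Notation K := (@munit M).

Lemma whiskl_comp W X Y Z (g : Y ~> Z) (f : X ~> Y) :
  W ◁ (g ∘ f) = (W ◁ g) ∘ (W ◁ f).
Proof. by rewrite -tensmM comp1m. Qed.

Lemma whiskr_comp W X Y Z (g : Y ~> Z) (f : X ~> Y) :
  (g ∘ f) ▷ W = (g ▷ W) ∘ (f ▷ W).
Proof. by rewrite -tensmM comp1m. Qed.

Lemma whisk_exch X X' Y Y' (f : X ~> X') (g : Y ~> Y') :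
  (f ▷ Y') ∘ (X ◁ g) = (X' ◁ g) ∘ (f ▷ Y).
Proof. by rewrite -!tensmM !comp1m !compm1. Qed.

Lemma assoc_natl X X' Y Z (f : X ~> X') :
  assoc X' Y Z ∘ ((f ▷ Y) ▷ Z) = (f ▷ (Y ⊗ Z)) ∘ assoc X Y Z.
Proof. by rewrite assoc_nat tensm1. Qed.

Lemma assoc_natm X Y Y' Z (f : Y ~> Y') :
  assoc X Y' Z ∘ ((X ◁ f) ▷ Z) = (X ◁ (f ▷ Z)) ∘ assoc X Y Z.
Proof. by rewrite assoc_nat. Qed.

Lemma assoc_natr X Y Z Z' (f : Z ~> Z') :
  assoc X Y Z' ∘ ((X ⊗ Y) ◁ f) = (X ◁ (Y ◁ f)) ∘ assoc X Y Z.
Proof. by rewrite -assoc_nat tensm1. Qed.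

Lemma associ_flip X Y Z X' Y' Z' (f : (X ⊗ Y) ⊗ Z ~> (X' ⊗ Y') ⊗ Z') g :
  assoc X' Y' Z' ∘ f = g ∘ assoc X Y Z ->
  associ X' Y' Z' ∘ g = f ∘ associ X Y Z.
Proof.
move=> fg; apply: (comp_mono (assocK X' Y' Z')).
by rewrite compA associK comp1m compA fg -compA associK compm1.
Qed.

Lemma pentagoni X Y Z W :
  assoc X (Y ⊗ Z) W ∘ (assoc X Y Z ▷ W) ∘ associ (X ⊗ Y) Z W =
  (X ◁ associ Y Z W) ∘ assoc X Y (Z ⊗ W).
Proof.
have aK : (X ◁ associ Y Z W) ∘ (X ◁ assoc Y Z W) = idm _.
  by rewrite -whiskl_comp assocK tensm1.
apply: (comp_mono aK); rewrite !compA -pentagon -compA associK compm1.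
by rewrite -whiskl_comp associK tensm1 comp1m.
Qed.

Lemma whiskl_unit_inj X Y (f g : X ~> Y) : K ◁ f = K ◁ g -> f = g.
Proof.
by move=> fg; apply: (comp_epi (lunitiK X)); rewrite -!lunit_nat fg.
Qed.

Lemma whiskr_unit_inj X Y (f g : X ~> Y) : f ▷ K = g ▷ K -> f = g.
Proof.
by move=> fg; apply: (comp_epi (runitiK X)); rewrite -!runit_nat fg.
Qed.

Lemma lunit_tens X Y : lunit (X ⊗ Y) ∘ assoc K X Y = lunit X ▷ Y.
Proof.
apply: whiskl_unit_inj.
apply: (comp_epi (associK K (K ⊗ X) Y)).
have aK : (assoc K K X ▷ Y) ∘ (associ K K X ▷ Y) = idm _.
  by rewrite -whiskr_comp associK tensm1.
apply: (comp_epi aK).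
rewrite whiskl_comp -!compA (compA (K ◁ assoc _ _ _)) -pentagon.
rewrite compA triangle -assoc_natl -triangle whiskr_comp.
by rewrite compA assoc_natm compA.
Qed.

Lemma runit_tens X Y : (X ◁ runit Y) ∘ assoc X Y K = runit (X ⊗ Y).
Proof.
apply: whiskr_unit_inj; apply: (comp_mono (assocK X Y K)).
rewrite whiskr_comp compA assoc_natm -triangle whiskl_comp -!compA.
by rewrite (compA (X ◁ assoc _ _ _)) -pentagon compA -assoc_natr -compA triangle.
Qed.

Lemma runit_unit X : runit (X ⊗ K) = runit X ▷ K.
Proof.
apply: (comp_mono (runitK X)).
by rewrite runit_nat.
Qed.

Lemma lunit_unit X : lunit (K ⊗ X) = K ◁ lunit X.
Proof. by apply: (comp_mono (lunitK X)); rewrite lunit_nat. Qed.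

Lemma lunit_tensi X Y : (lunit X ▷ Y) ∘ associ K X Y = lunit (X ⊗ Y).
Proof. by rewrite -lunit_tens -compA associK compm1. Qed.

Lemma runit_tensi X Y : runit (X ⊗ Y) ∘ associ X Y K = X ◁ runit Y.
Proof. by rewrite -runit_tens -compA associK compm1. Qed.

Lemma trianglei X Y : (runit X ▷ Y) ∘ associ X K Y = X ◁ lunit Y.
Proof. by rewrite -triangle -compA associK compm1. Qed.

End MonoidalFacts.

Section BraidedFacts.
Context (M : braided_category).
Implicit Types X Y Z W V : M.
Notation K := (@munit M).

Lemma lunit_braid X : lunit X ∘ braid X K = runit X.
Proof.
set f := lunit X ∘ braid X K; apply: whiskr_unit_inj.
have fK : (braidi X K ∘ luniti X) ∘ f = idm _.
  by rewrite /f -compA (comp_l (lunitK X)) comp1m braidK.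
apply: (comp_mono fK); rewrite -runit_unit -runit_tens {2}/f; symmetry.
rewrite -compA (comp_l (braid_nat _ _)) -triangle -!compA.
rewrite (compA (assoc K K X)) hexagon_r -!compA.
rewrite (compA (K ◁ lunit X)) -whiskl_comp -/f (comp_l (lunit_nat _)) -!compA.
by rewrite (comp_l (lunit_tens _ _)) -whiskr_comp.
Qed.

Lemma runit_braid X : runit X ∘ braid K X = lunit X.
Proof.
set f := runit X ∘ braid K X; apply: whiskl_unit_inj.
have fK : (braidi K X ∘ runiti X) ∘ f = idm _.
  by rewrite /f -compA (comp_l (runitK X)) comp1m braidK.
apply: (comp_mono fK); rewrite -lunit_unit {3}/f; symmetry.
rewrite -lunit_tensi -compA (comp_l (braid_nat _ _)) -trianglei -!compA.
rewrite (compA (associ X K K)).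
rewrite hexagon_l -!compA (compA (runit X ▷ K)) -whiskr_comp -/f.
rewrite (comp_l (runit_nat _)) -compA (comp_l (runit_tensi _ _)).
by rewrite -whiskl_comp compA.
Qed.

(* The braiding [X ⊗ Y ⊗ W -> Y ⊗ X ⊗ W], bracketed to the right. *)
Definition swap X Y W : X ⊗ (Y ⊗ W) ~> Y ⊗ (X ⊗ W) :=
  locked (assoc Y X W ∘ (braid X Y ▷ W) ∘ associ X Y W).

Lemma swapE X Y W :
  swap X Y W = assoc Y X W ∘ (braid X Y ▷ W) ∘ associ X Y W.
Proof. by rewrite /swap -lock. Qed.

Lemma swap_assoc X Y W :
  swap X Y W ∘ assoc X Y W = assoc Y X W ∘ (braid X Y ▷ W).
Proof. by rewrite !swapE -compA assocK compm1. Qed.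

Lemma swap_natr X Y W W' (h : W ~> W') :
  swap X Y W' ∘ (X ◁ (Y ◁ h)) = (Y ◁ (X ◁ h)) ∘ swap X Y W.
Proof.
rewrite !swapE -!compA (associ_flip (assoc_natr _ _ _)).
by rewrite (comp_l (whisk_exch _ _)) -compA (comp_l (assoc_natr _ _ _)) -compA.
Qed.

Lemma swap_natl X X' Y W (f : X ~> X') :
  swap X' Y W ∘ (f ▷ (Y ⊗ W)) = (Y ◁ (f ▷ W)) ∘ swap X Y W.
Proof.
rewrite !swapE -!compA (associ_flip (assoc_natl _ _ _)).
rewrite (compA (_ ▷ W)) -whiskr_comp braid_nat whiskr_comp -compA.
by rewrite (comp_l (assoc_natm _ _ _)) -compA.
Qed.

Lemma swap_natm X Y Y' W (g : Y ~> Y') :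
  swap X Y' W ∘ (X ◁ (g ▷ W)) = (g ▷ (X ⊗ W)) ∘ swap X Y W.
Proof.
rewrite !swapE -!compA (associ_flip (assoc_natm _ _ _)).
rewrite (compA (_ ▷ W)) -whiskr_comp braid_nat whiskr_comp -compA.
by rewrite (comp_l (assoc_natl _ _ _)) -compA.
Qed.

Lemma swap_whisk Y B V W :
  (B ◁ assoc Y V W) ∘ assoc B (Y ⊗ V) W ∘ (swap Y B V ▷ W) =
  swap Y B (V ⊗ W) ∘ (Y ◁ assoc B V W) ∘ assoc Y (B ⊗ V) W.
Proof.
rewrite !swapE !whiskr_comp !compA -pentagon -(compA (assoc _ _ _)) assoc_natl.
rewrite -!compA; congr (_ ∘ (_ ∘ _)).
have aK : (assoc Y B V ▷ W) ∘ (associ Y B V ▷ W) = idm _.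
  by rewrite -whiskr_comp associK tensm1.
have Ka : (associ Y B V ▷ W) ∘ (assoc Y B V ▷ W) = idm _.
  by rewrite -whiskr_comp assocK tensm1.
apply: (comp_epi aK); rewrite -!compA Ka compm1.
by rewrite (compA (Y ◁ _)) -pentagon compA assocK comp1m.
Qed.

Lemma braid_tensl Y Z B :
  braid (Y ⊗ Z) B = swap Y B Z ∘ (Y ◁ braid Z B) ∘ assoc Y Z B.
Proof.
apply: (comp_mono (associK _ _ _)); apply: (comp_epi (assocK _ _ _)).
rewrite hexagon_l swapE -!compA associK compm1.
by rewrite (comp_l (assocK _ _ _)) comp1m.
Qed.

Lemma braid_tensr Z B C :
  assoc B C Z ∘ braid Z (B ⊗ C) = (B ◁ braid Z C) ∘ swap Z B C.
Proof.
apply: (comp_epi (associK _ _ _)).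
by rewrite hexagon_r swapE -!compA assocK compm1.
Qed.

Lemma swap_tensl Y Z B W :
  (B ◁ assoc Y Z W) ∘ swap (Y ⊗ Z) B W =
  swap Y B (Z ⊗ W) ∘ (Y ◁ swap Z B W) ∘ assoc Y Z (B ⊗ W).
Proof.
apply: (comp_epi (associK _ _ _)).
rewrite -!compA swap_assoc braid_tensl !whiskr_comp -!compA.
rewrite (compA (assoc _ _ _)) (compA (B ◁ _)) (compA (B ◁ _)) swap_whisk.
rewrite -!compA; congr (_ ∘ _).
rewrite !swapE !whiskl_comp -!compA; congr (_ ∘ _).
rewrite (comp_l (assoc_natm _ _ _)) -compA; congr (_ ∘ _).
by rewrite pentagon -!compA (compA (Y ◁ associ _ _ _)) -whiskl_comp assocK
  tensm1 comp1m.
Qed.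

Lemma swap_tensm Z B C W :
  assoc B C (Z ⊗ W) ∘ swap Z (B ⊗ C) W =
  (B ◁ swap Z C W) ∘ swap Z B (C ⊗ W) ∘ (Z ◁ assoc B C W).
Proof.
apply: (comp_epi (associK _ _ _)).
rewrite -!compA (compA (swap _ _ _) (Z ◁ _)).
rewrite -swap_whisk.
rewrite -!compA swap_assoc (compA (assoc B C _)) pentagon -!compA.
rewrite -whiskr_comp braid_tensr whiskr_comp.
rewrite (compA (assoc _ _ _)) assoc_natm -!compA (swapE Z C W) !whiskl_comp -!compA.
congr (_ ∘ (_ ∘ _)).
by rewrite (compA (B ◁ associ _ _ _)) -whiskl_comp assocK tensm1 comp1m.
Qed.

Lemma swap_unitm X W : lunit (X ⊗ W) ∘ swap X K W = X ◁ lunit W.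
Proof.
rewrite !swapE !compA lunit_tens -whiskr_comp lunit_braid.
by rewrite trianglei.
Qed.

Lemma swap_unitl B W : (B ◁ lunit W) ∘ swap K B W = lunit (B ⊗ W).
Proof.
rewrite !swapE !compA triangle -whiskr_comp runit_braid.
by rewrite lunit_tensi.
Qed.

End BraidedFacts.

Section InducedMonad.
Context (M : braided_category) (B : weak_bimonoid M).
Implicit Types X Y Z : M.
Notation K := (@munit M).

Definition tensB X : M := X ⊗ B.
Definition tensB_mul X : (X ⊗ B) ⊗ B ~> X ⊗ B := (X ◁ mu B) ∘ assoc X B B.
Definition tensB_unit X : X ~> X ⊗ B := (X ◁ eta B) ∘ runiti X.
Definition tensB_tau X Y : (X ⊗ Y) ⊗ B ~> (X ⊗ B) ⊗ (Y ⊗ B) :=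
  inner X B (braid Y B) ∘ ((X ⊗ Y) ◁ delta B).
Definition tensB_tau0 : K ⊗ B ~> K := eps B ∘ lunit B.

Definition coact X : X ⊗ B ~> B ⊗ (X ⊗ B) :=
  locked (swap X B B ∘ (X ◁ delta B)).

Lemma coactE X : coact X = swap X B B ∘ (X ◁ delta B).
Proof. by rewrite /coact -lock. Qed.

Lemma tensB_tauE X Y :
  tensB_tau X Y = associ X B (Y ⊗ B) ∘ (X ◁ coact Y) ∘ assoc X Y B.
Proof.
rewrite /tensB_tau /inner -!compA assoc_natr (compA (X ◁ _)) -whiskl_comp.
by rewrite coactE swapE -!compA.
Qed.

Lemma assoc_tau X Y :
  assoc X B (Y ⊗ B) ∘ tensB_tau X Y = (X ◁ coact Y) ∘ assoc X Y B.
Proof. by rewrite tensB_tauE -!compA (comp_l (associK _ _ _)) comp1m. Qed.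

Lemma coact_nat X Y (f : X ~> Y) :
  coact Y ∘ (f ▷ B) = (B ◁ (f ▷ B)) ∘ coact X.
Proof.
rewrite !coactE -compA -whisk_exch !compA; congr (_ ∘ _).
exact: swap_natl.
Qed.

Lemma coactA X :
  assoc B B (X ⊗ B) ∘ (delta B ▷ (X ⊗ B)) ∘ coact X = (B ◁ coact X) ∘ coact X.
Proof.
rewrite !coactE -!compA (compA (delta B ▷ _)) -swap_natm -!compA.
rewrite (compA (assoc _ _ _)) swap_tensm -!compA whiskl_comp -!compA.
congr (_ ∘ _).
rewrite (compA (B ◁ (X ◁ _))) -swap_natr -!compA; congr (_ ∘ _).
by rewrite -!whiskl_comp compA deltaA.
Qed.

Lemma coact_tens Y Z :
  (B ◁ assoc Y Z B) ∘ coact (Y ⊗ Z) =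
  swap Y B (Z ⊗ B) ∘ (Y ◁ coact Z) ∘ assoc Y Z B.
Proof.
rewrite !coactE compA swap_tensl -!compA assoc_natr.
by rewrite (compA (Y ◁ swap _ _ _)) -whiskl_comp.
Qed.

Lemma coact_counit X : lunit (X ⊗ B) ∘ (eps B ▷ (X ⊗ B)) ∘ coact X = idm _.
Proof.
rewrite coactE -!compA (compA (eps B ▷ _)) -swap_natm -!compA.
rewrite (compA (lunit _)) swap_unitm -!whiskl_comp delta1m.
by rewrite lunitiK tensm1.
Qed.

Lemma tensB_tau_nat X X' Y Y' (f : X ~> X') (g : Y ~> Y') :
  tensB_tau X' Y' ∘ ((f ⊠ g) ▷ B) = ((f ▷ B) ⊠ (g ▷ B)) ∘ tensB_tau X Y.
Proof.
rewrite !tensB_tauE -!compA assoc_nat (compA (X' ◁ _)) -tensmM comp1m coact_nat.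
rewrite -[f in f ⊠ _]compm1 tensmM.
have /associ_flip e := assoc_nat f (idm B) (g ▷ B).
by rewrite -compA (comp_l e) -!compA.
Qed.

Lemma coact_tau Y Z :
  assoc B (Y ⊗ B) (Z ⊗ B) ∘ (coact Y ▷ (Z ⊗ B)) ∘ associ Y B (Z ⊗ B)
    ∘ (Y ◁ coact Z) ∘ assoc Y Z B =
  (B ◁ tensB_tau Y Z) ∘ coact (Y ⊗ Z).
Proof.
have aK : (B ◁ associ Y B (Z ⊗ B)) ∘ (B ◁ assoc Y B (Z ⊗ B)) = idm _.
  by rewrite -whiskl_comp assocK tensm1.
apply: (comp_mono aK).
rewrite [in RHS]compA -whiskl_comp assoc_tau whiskl_comp -[in RHS]compA coact_tens.
rewrite !compA -swap_natr {1}coactE whiskr_comp !compA swap_whisk.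
rewrite -!compA (compA (assoc Y _ _)) assoc_natm -!compA.
rewrite (compA (assoc Y B (Z ⊗ B))) associK comp1m.
congr (_ ∘ _); rewrite !compA; congr (_ ∘ _).
by rewrite -!whiskl_comp coactA.
Qed.

Lemma tensB_tauA X Y Z :
  assoc _ _ _ ∘ (tensB_tau X Y ▷ (Z ⊗ B)) ∘ tensB_tau (X ⊗ Y) Z =
  ((X ⊗ B) ◁ tensB_tau Y Z) ∘ tensB_tau X (Y ⊗ Z) ∘ (assoc X Y Z ▷ B).
Proof.
apply: (comp_mono (assocK X B _)).
rewrite (tensB_tauE (X ⊗ Y)) (tensB_tauE X (Y ⊗ Z)) !compA assoc_natr pentagon.
rewrite -(compA _ (assoc X B _ ▷ _)) -whiskr_comp assoc_tau whiskr_comp.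
rewrite !compA -(compA _ (assoc X _ _)) assoc_natm !compA.
rewrite -(compA _ (assoc X B _) (associ X B _)) associK compm1.
rewrite -(compA _ (assoc X _ _) (_ ▷ _)) -(compA _ _ (associ _ _ _)) pentagoni.
rewrite !compA -(compA _ (assoc X Y _)) assoc_natr !compA.
rewrite -(compA _ (assoc X Y _)) pentagon !compA.
by rewrite -!whiskl_comp coact_tau.
Qed.

Lemma tensB_tau1m X :
  lunit (X ⊗ B) ∘ (tensB_tau0 ▷ (X ⊗ B)) ∘ tensB_tau K X = lunit X ▷ B.
Proof.
rewrite /tensB_tau0 whiskr_comp tensB_tauE -!compA.
rewrite (compA (lunit B ▷ _)) lunit_tensi (compA (lunit _) (K ◁ _)) lunit_nat.
by rewrite -!compA lunit_tens !compA coact_counit comp1m.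
Qed.

Lemma tensB_taum1 X :
  runit (X ⊗ B) ∘ ((X ⊗ B) ◁ tensB_tau0) ∘ tensB_tau X K = runit X ▷ B.
Proof.
rewrite tensB_tauE -!compA.
have /associ_flip e := assoc_natr X B tensB_tau0.
rewrite (compA ((X ⊗ B) ◁ _)) -e -!compA (compA (runit _)) runit_tensi.
rewrite (compA (X ◁ (B ◁ _))) (compA (X ◁ runit _)) -!whiskl_comp -triangle.
congr (_ ∘ _); congr (X ◁ _).
rewrite coactE /tensB_tau0 whiskl_comp -!compA (compA (B ◁ lunit _)).
rewrite swap_unitl lunit_nat (compA (B ◁ _)) deltam1 compA.
by rewrite runitiK comp1m.
Qed.


Lemma tensB_mul_nat X Y (f : X ~> Y) :
  tensB_mul Y ∘ ((f ▷ B) ▷ B) = (f ▷ B) ∘ tensB_mul X.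
Proof. by rewrite /tensB_mul -!compA assoc_natl !compA whisk_exch. Qed.

Lemma tensB_unit_nat X Y (f : X ~> Y) :
  tensB_unit Y ∘ f = (f ▷ B) ∘ tensB_unit X.
Proof.
rewrite /tensB_unit compA whisk_exch -!compA; congr (_ ∘ _).
apply: (comp_mono (runitK Y)).
by rewrite !compA runitiK comp1m runit_nat -compA runitiK compm1.
Qed.

Lemma tensB_mulA X :
  tensB_mul X ∘ tensB_mul (X ⊗ B) = tensB_mul X ∘ (tensB_mul X ▷ B).
Proof.
rewrite /tensB_mul -!compA (compA (assoc _ _ _)) assoc_natr -!compA pentagon.
rewrite whiskr_comp (compA (assoc X B B) (_ ▷ B)) assoc_natm !compA.
by rewrite -!whiskl_comp muA.
Qed.

Lemma tensB_mulu X : tensB_mul X ∘ tensB_unit (X ⊗ B) = idm (X ⊗ B).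
Proof.
rewrite /tensB_mul /tensB_unit -!compA (compA (assoc _ _ _)) assoc_natr -!compA.
by rewrite compA -whiskl_comp mum1 compA runit_tens runitiK.
Qed.

Lemma tensB_mulTu X : tensB_mul X ∘ (tensB_unit X ▷ B) = idm (X ⊗ B).
Proof.
rewrite /tensB_mul /tensB_unit whiskr_comp -!compA (compA (assoc _ _ _)).
rewrite assoc_natm -!compA compA -whiskl_comp mu1m compA triangle.
by rewrite -whiskr_comp runitiK tensm1.
Qed.

Definition induced_weak_bimonad : opmonoidal_functor_monad M :=
  @OpmonoidalFunctorMonad M tensB (fun X Y f => f ▷ B)
    tensB_mul tensB_unit tensB_tau tensB_tau0
    (fun X => tensm1 X B) (whiskr_comp B)
    tensB_mul_nat tensB_unit_nat tensB_mulA tensB_mulu tensB_mulTu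
    tensB_tau_nat tensB_tauA tensB_tau1m tensB_taum1.

End InducedMonad.

(* Main.v *)
(** The idea: writing G f for the endomorphism a ⊗ b ↦ a f(b_1) ⊗ b_2 of B ⊗ B, one has
    G f ∘ G g = G (g ∗ f), and f is recovered from G f by unit and counit. With the objects X
    and Y carried along, [can] is G id, the idempotent E is G t and the idempotent F is G r
    (up to associativity), so an antipode nu gives chi = G nu. Conversely, the equations for
    chi at X = Y = K force it to commute with left multiplication and right comultiplication,
    because can, E and F do; hence chi = G nu for some nu, and the equations for chi become
    those for nu.

    The identities E = G t and F = G r are string diagram computations. A morphism
    f : X -> Y is replaced by the natural family f ⊗ W, read between right-bracketed tensor
    products X1 ⊗ (X2 ⊗ (... ⊗ W)); this makes all coherence isomorphisms disappear, and
    interchange becomes naturality in W. *)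
From mathcomp Require Import ssreflect ssrfun.
Require Import Defs.

Set Implicit Arguments.
Unset Strict Implicit.
Unset Printing Implicit Defensive.
Local Open Scope cat_scope.

(** * Strictification *)

Section Flattening.
Context (M : monoidal_category).
Implicit Types X Y Z W V : M.
Notation K := (@munit M).

(** The bracketing of an object cannot be read off inside [M], so it is recorded in a syntax tree
    whose leaves [OVar] are objects treated as atoms. *)
Inductive oexpr := OVar of M | OUnit | OTens of oexpr & oexpr.

Fixpoint oev a : M :=
  match a with OVar X => X | OUnit => K | OTens a b => oev a ⊗ oev b end.

(* The right-bracketed product of the factors of [a] in front of [W]. *)
Fixpoint ofl a W : M :=
  match a with OVar X => X ⊗ W | OUnit => W | OTens a b => ofl a (ofl b W) end.

Fixpoint ofm a W W' (f : W ~> W') : ofl a W ~> ofl a W' :=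
  match a with
  | OVar X => X ◁ f | OUnit => f | OTens a b => ofm a (ofm b f)
  end.

Fixpoint sh a W : oev a ⊗ W ~> ofl a W :=
  match a with
  | OVar X => idm (X ⊗ W)
  | OUnit => lunit W
  | OTens a b => sh a (ofl b W) ∘ (oev a ◁ sh b W) ∘ assoc (oev a) (oev b) W
  end.

Fixpoint shi a W : ofl a W ~> oev a ⊗ W :=
  match a with
  | OVar X => idm (X ⊗ W)
  | OUnit => luniti W
  | OTens a b => associ (oev a) (oev b) W ∘ (oev a ◁ shi b W) ∘ shi a (ofl b W)
  end.

Lemma shK a W : shi a W ∘ sh a W = idm _.
Proof.
elim: a W => [X|//=|a IHa b IHb] W /=; [exact: comp1m|exact: lunitK|].
rewrite -!compA (comp_l (IHa _)) comp1m (comp_l (esym (whiskl_comp _ _ _))) IHb.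
by rewrite tensm1 comp1m assocK.
Qed.

Lemma shiK a W : sh a W ∘ shi a W = idm _.
Proof.
elim: a W => [X|//=|a IHa b IHb] W /=; [exact: comp1m|exact: lunitiK|].
rewrite -!compA (comp_l (associK _ _ _)) comp1m.
by rewrite (comp_l (esym (whiskl_comp _ _ _))) IHb tensm1 comp1m IHa.
Qed.

Lemma sh_nat a W W' (f : W ~> W') : sh a W' ∘ (oev a ◁ f) = ofm a f ∘ sh a W.
Proof.
elim: a W W' f => [X|//=|a IHa b IHb] W W' f /=.
- by rewrite comp1m compm1.
- exact: lunit_nat.
- rewrite -!compA assoc_natr (comp_l (esym (whiskl_comp _ _ _))) IHb.
  by rewrite whiskl_comp -!compA (comp_l (IHa _ _ _)) -!compA.
Qed.

(* Locked here and below, so that [rewrite] does not find compositions by unfolding. *)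
Definition flat a b (f : oev a ~> oev b) W : ofl a W ~> ofl b W :=
  locked (sh b W ∘ (f ▷ W) ∘ shi a W).

Lemma flatE a b (f : oev a ~> oev b) W : flat f W = sh b W ∘ (f ▷ W) ∘ shi a W.
Proof. by rewrite /flat -lock. Qed.

Lemma flat_sh a b (f : oev a ~> oev b) W : flat f W ∘ sh a W = sh b W ∘ (f ▷ W).
Proof. by rewrite flatE -!compA shK compm1. Qed.

Lemma flat_unique a b (f : oev a ~> oev b) W g :
  sh b W ∘ (f ▷ W) = g ∘ sh a W -> flat f W = g.
Proof. by move=> e; apply: (comp_epi (shiK a W)); rewrite flat_sh. Qed.

Lemma flat_nat a b (f : oev a ~> oev b) W W' (h : W ~> W') :
  flat f W' ∘ ofm a h = ofm b h ∘ flat f W.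
Proof.
apply: (comp_epi (shiK a W)); rewrite -!compA -sh_nat flat_sh (comp_l (flat_sh _ _)).
by rewrite -compA whisk_exch compA sh_nat -compA.
Qed.

(** The component at the unit object suffices: it determines f ▷ K, and whiskering with the unit
    object is faithful. *)
Lemma flat_inj a b (f g : oev a ~> oev b) :
  (forall W, flat f W = flat g W) -> f = g.
Proof.
move=> fg; apply: whiskr_unit_inj; apply: (comp_mono (shK b K)).
by rewrite -!flat_sh fg.
Qed.

Definition strandF X Y (f : X ~> Y) W : X ⊗ W ~> Y ⊗ W :=
  @flat (OVar X) (OVar Y) f W.

Lemma strandFE X Y (f : X ~> Y) W : strandF f W = f ▷ W.
Proof. by rewrite /strandF flatE /= comp1m compm1. Qed.

Lemma strand_nat X Y (f : X ~> Y) W W' (h : W ~> W') :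
  strandF f W' ∘ (X ◁ h) = (Y ◁ h) ∘ strandF f W.
Proof. exact: (@flat_nat (OVar X) (OVar Y)). Qed.

Lemma strand_comp X Y Z (g : Y ~> Z) (f : X ~> Y) W :
  strandF (g ∘ f) W = strandF g W ∘ strandF f W.
Proof. by rewrite !strandFE whiskr_comp. Qed.

Inductive mexpr : oexpr -> oexpr -> Type :=
| MGen a b of oev a ~> oev b : mexpr a b
| MId a : mexpr a a
| MComp a b c of mexpr b c & mexpr a b : mexpr a c
| MTens a a' b b' of mexpr a a' & mexpr b b' : mexpr (OTens a b) (OTens a' b')
| MAssoc a b c : mexpr (OTens (OTens a b) c) (OTens a (OTens b c))
| MAssoci a b c : mexpr (OTens a (OTens b c)) (OTens (OTens a b) c)
| MLunit a : mexpr (OTens OUnit a) a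
| MLuniti a : mexpr a (OTens OUnit a)
| MRunit a : mexpr (OTens a OUnit) a
| MRuniti a : mexpr a (OTens a OUnit).

Fixpoint mev a b (f : mexpr a b) : oev a ~> oev b :=
  match f in mexpr a b return oev a ~> oev b with
  | MGen _ _ f => f
  | MId a => idm _
  | MComp _ _ _ g f => mev g ∘ mev f
  | MTens _ _ _ _ f g => mev f ⊠ mev g
  | MAssoc a b c => assoc _ _ _
  | MAssoci a b c => associ _ _ _
  | MLunit a => lunit _
  | MLuniti a => luniti _
  | MRunit a => runit _
  | MRuniti a => runiti _
  end.

(** Coherence isomorphisms can be sent to identities because [ofl] computes to the same object on
    both sides. For [MTens] the right factor is applied first. *)
Fixpoint mfl a b (f : mexpr a b) W : ofl a W ~> ofl b W :=
  match f in mexpr a b return ofl a W ~> ofl b W with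
  | MGen _ _ f => flat f W
  | MId a => idm _
  | MComp _ _ _ g f => mfl g W ∘ mfl f W
  | MTens a a' b b' f g => mfl f (ofl b' W) ∘ ofm a (mfl g W)
  | MAssoc a b c => idm _
  | MAssoci a b c => idm _
  | MLunit a => idm _
  | MLuniti a => idm _
  | MRunit a => idm _
  | MRuniti a => idm _
  end.

Lemma mfl_assoc a b c W :
  sh (OTens a (OTens b c)) W ∘ (assoc (oev a) (oev b) (oev c) ▷ W) =
  sh (OTens (OTens a b) c) W.
Proof.
rewrite /= !whiskl_comp -!compA; congr (_ ∘ _).
rewrite [in RHS](compA (assoc _ _ _)) assoc_natr -!compA; congr (_ ∘ _).
by rewrite pentagon -!compA.
Qed.

Lemma mfl_runit a W : sh a W ∘ (runit (oev a) ▷ W) = sh (OTens a OUnit) W.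
Proof. by rewrite /= -triangle compA. Qed.

Lemma mfl_lunit a W : sh a W ∘ (lunit (oev a) ▷ W) = sh (OTens OUnit a) W.
Proof. by rewrite /= lunit_nat -compA lunit_tens. Qed.

(** Induction on the expression: associators need the pentagon, unit constraints the triangle and
    its consequence for [lunit]; a tensor product is split by interchange, and naturality of [sh]
    moves the right factor past the left one. *)
Lemma mflE a b (f : mexpr a b) W : flat (mev f) W = mfl f W.
Proof.
apply: flat_unique.
elim: f W => {a b} [a b f|a|a b c g IHg f IHf|a a' b b' f IHf g IHg|||a|a|a|a] W.
- by rewrite flat_sh.
- by rewrite /= tensm1 comp1m compm1.
- by rewrite /= whiskr_comp compA IHg -!compA IHf.
- rewrite /= -!compA assoc_nat [RHS]compA.
  have -> : mev f ⊠ (mev g ▷ W) = (mev f ▷ (oev b' ⊗ W)) ∘ (oev a ◁ (mev g ▷ W)).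
    by rewrite -tensmM comp1m compm1.
  rewrite -!compA (comp_l (esym (whisk_exch _ _))) -!compA (comp_l (IHf _)) -!compA.
  congr (_ ∘ _); rewrite (comp_l (esym (whiskl_comp _ _ _))) IHg whiskl_comp.
  by rewrite -!compA (comp_l (sh_nat _ _)) -!compA.
- by move=> a b c; rewrite mfl_assoc comp1m.
- move=> a b c; rewrite /mev -mfl_assoc -compA -whiskr_comp associK tensm1.
  by rewrite compm1 comp1m.
- by rewrite mfl_lunit comp1m.
- by rewrite -mfl_lunit -compA -whiskr_comp lunitiK tensm1 compm1 comp1m.
- by rewrite mfl_runit comp1m.
- by rewrite -mfl_runit -compA -whiskr_comp runitiK tensm1 compm1 comp1m.
Qed.

Lemma mfl_eq a b (f g : mexpr a b) W : mev f = mev g -> mfl f W = mfl g W.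
Proof. by move=> fg; rewrite -!mflE fg. Qed.

Lemma mev_eq a b (f g : mexpr a b) : (forall W, mfl f W = mfl g W) -> mev f = mev g.
Proof. by move=> fg; apply: flat_inj => W; rewrite !mflE. Qed.

Lemma flat_comp a b c (g : oev b ~> oev c) (f : oev a ~> oev b) W :
  @flat a c (g ∘ f) W = @flat b c g W ∘ @flat a b f W.
Proof. exact: (mflE (MComp (MGen g) (MGen f)) W). Qed.

End Flattening.

(** * Reification of objects and morphisms *)

Ltac reify_ob M X :=
  lazymatch X with
  | tens ?Y ?Z =>
      let a := reify_ob M Y in let b := reify_ob M Z in constr:(@OTens M a b)
  | munit => constr:(@OUnit M)
  | _ => constr:(@OVar M X)
  end.

(** A morphism of any other shape becomes a generator, so a constant stays opaque unless it is
    unfolded before flattening. *)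
Ltac reify_mor M f :=
  lazymatch f with
  | comp ?g ?h =>
      let g' := reify_mor M g in let h' := reify_mor M h in constr:(MComp g' h')
  | tensm ?g ?h =>
      let g' := reify_mor M g in let h' := reify_mor M h in constr:(MTens g' h')
  | idm ?X => let a := reify_ob M X in constr:(MId a)
  | assoc ?X ?Y ?Z =>
      let a := reify_ob M X in let b := reify_ob M Y in let c := reify_ob M Z in
      constr:(MAssoc a b c)
  | associ ?X ?Y ?Z =>
      let a := reify_ob M X in let b := reify_ob M Y in let c := reify_ob M Z in
      constr:(MAssoci a b c)
  | lunit ?X => let a := reify_ob M X in constr:(MLunit a)
  | luniti ?X => let a := reify_ob M X in constr:(MLuniti a)
  | runit ?X => let a := reify_ob M X in constr:(MRunit a)
  | runiti ?X => let a := reify_ob M X in constr:(MRuniti a)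
  | _ =>
      lazymatch type of f with
      | hom ?X ?Y =>
          let a := reify_ob M X in let b := reify_ob M Y in
          constr:(@MGen M a b f)
      end
  end.

Ltac flat_normalize := cbn [mfl ofm ofl]; rewrite ?tensm1 ?comp1m ?compm1.

Ltac flatten M W :=
  lazymatch goal with
  | |- ?f = ?g =>
      let f' := reify_mor M f in let g' := reify_mor M g in
      refine (@mev_eq M _ _ f' g' _); intro W; flat_normalize
  end.

Ltac flatten_in M W H :=
  lazymatch type of H with
  | ?f = ?g =>
      let f' := reify_mor M f in let g' := reify_mor M g in
      move: (@mfl_eq M _ _ f' g' W H); clear H; flat_normalize
  end.

Section Whiskering.
Context (M : monoidal_category).
Implicit Types X Y Z W V : M.

Lemma comp_l3 X1 X2 X3 X4 (h : X3 ~> X4) (g : X2 ~> X3) (f : X1 ~> X2) k :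
  h ∘ (g ∘ f) = k -> forall X0 (f' : X0 ~> X1), h ∘ (g ∘ (f ∘ f')) = k ∘ f'.
Proof. by move=> <- X0 f'; rewrite -!compA. Qed.

Lemma comp_l4 X1 X2 X3 X4 X5 (i : X4 ~> X5) (h : X3 ~> X4) (g : X2 ~> X3) (f : X1 ~> X2) k :
  i ∘ (h ∘ (g ∘ f)) = k -> forall X0 (f' : X0 ~> X1), i ∘ (h ∘ (g ∘ (f ∘ f'))) = k ∘ f'.
Proof. by move=> <- X0 f'; rewrite -!compA. Qed.

Lemma whisk2 V X1 X2 X3 (g : X2 ~> X3) (f : X1 ~> X2) k :
  g ∘ f = k -> (V ◁ g) ∘ (V ◁ f) = V ◁ k.
Proof. by move=> <-; rewrite whiskl_comp. Qed.

Lemma whisk3 V X1 X2 X3 X4 (h : X3 ~> X4) (g : X2 ~> X3) (f : X1 ~> X2) k :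
  h ∘ (g ∘ f) = k -> (V ◁ h) ∘ ((V ◁ g) ∘ (V ◁ f)) = V ◁ k.
Proof. by move=> <-; rewrite !whiskl_comp. Qed.

End Whiskering.

(** * Weak bimonoid identities *)

Section WeakBimonoid.
Context (M : braided_category) (B : weak_bimonoid M).
Implicit Types X Y Z W V : M.
Notation K := (@munit M).
Notation oB := (@OVar M (carrier B)).
Notation oBB := (OTens oB oB).

Definition swapi X Y W : Y ⊗ (X ⊗ W) ~> X ⊗ (Y ⊗ W) :=
  @flat M (OTens (OVar Y) (OVar X)) (OTens (OVar X) (OVar Y)) (braidi X Y) W.
Definition muF W : B ⊗ (B ⊗ W) ~> B ⊗ W := @flat M oBB oB (mu B) W.
Definition deltaF W : B ⊗ W ~> B ⊗ (B ⊗ W) := @flat M oB oBB (delta B) W.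
Definition etaF W : W ~> B ⊗ W := @flat M (OUnit M) oB (eta B) W.
Definition epsF W : B ⊗ W ~> W := @flat M oB (OUnit M) (eps B) W.
(* With 1_1 ⊗ 1_2 = [copairF] = δη and with c^-1 δη = [copairiF], the maps t and r become
   planar: t(b) = ε(b 1_2) 1_1 and r(b) = 1_2 ε(1_1 b), the copy of δη being braided by c^-1.
   Moreover φ(b) = ε(b 1_1) 1_2. *)
Definition pairF W : B ⊗ (B ⊗ W) ~> W := locked (epsF W ∘ muF W).
Definition copairF W : W ~> B ⊗ (B ⊗ W) := locked (deltaF W ∘ etaF W).
Definition copairiF W : W ~> B ⊗ (B ⊗ W) := locked (swapi B B W ∘ copairF W).
Definition targetF W : B ⊗ W ~> B ⊗ W := locked (pairF (B ⊗ W) ∘ (B ◁ copairiF W)).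
Definition sourceF W : B ⊗ W ~> B ⊗ W := locked ((B ◁ pairF W) ∘ copairiF (B ⊗ W)).
Definition phiF W : B ⊗ W ~> B ⊗ W := locked (pairF (B ⊗ W) ∘ (B ◁ copairF W)).

Lemma pairFE W : pairF W = epsF W ∘ muF W.
Proof. by rewrite /pairF -lock. Qed.

Lemma copairFE W : copairF W = deltaF W ∘ etaF W.
Proof. by rewrite /copairF -lock. Qed.

Lemma copairiFE W : copairiF W = swapi B B W ∘ copairF W.
Proof. by rewrite /copairiF -lock. Qed.

Lemma targetFE W : targetF W = pairF (B ⊗ W) ∘ (B ◁ copairiF W).
Proof. by rewrite /targetF -lock. Qed.

Lemma sourceFE W : sourceF W = (B ◁ pairF W) ∘ copairiF (B ⊗ W).
Proof. by rewrite /sourceF -lock. Qed.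

Lemma phiFE W : phiF W = pairF (B ⊗ W) ∘ (B ◁ copairF W).
Proof. by rewrite /phiF -lock. Qed.

Lemma flat_braid X Y W :
  @flat M (OTens (OVar X) (OVar Y)) (OTens (OVar Y) (OVar X)) (braid X Y) W = swap X Y W.
Proof. by rewrite flatE swapE /= !tensm1 !compm1 !comp1m. Qed.

Ltac fold_fam :=
  rewrite ?flat_braid -?/(muF _ _) -?/(deltaF _ _) -?/(etaF _ _) -?/(epsF _ _)
    -?/(swapi _ _ _) -?/(strandF _ _) ?whiskl_comp -?compA.

Ltac flatten_lhs M :=
  lazymatch goal with
  | |- flat ?f ?W = _ =>
      let f' := reify_mor M f in refine (eq_trans (@mflE M _ _ f' W) _);
      flat_normalize; fold_fam
  end.

Lemma muF_nat W W' (f : W ~> W') : muF W' ∘ (B ◁ (B ◁ f)) = (B ◁ f) ∘ muF W.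
Proof. exact: (@flat_nat _ oBB oB). Qed.

Lemma deltaF_nat W W' (f : W ~> W') : deltaF W' ∘ (B ◁ f) = (B ◁ (B ◁ f)) ∘ deltaF W.
Proof. exact: (@flat_nat _ oB oBB). Qed.

Lemma etaF_nat W W' (f : W ~> W') : etaF W' ∘ f = (B ◁ f) ∘ etaF W.
Proof. exact: (@flat_nat _ (OUnit M) oB). Qed.

Lemma epsF_nat W W' (f : W ~> W') : epsF W' ∘ (B ◁ f) = f ∘ epsF W.
Proof. exact: (@flat_nat _ oB (OUnit M)). Qed.

Lemma swapi_nat X Y W W' (f : W ~> W') :
  swapi X Y W' ∘ (Y ◁ (X ◁ f)) = (X ◁ (Y ◁ f)) ∘ swapi X Y W.
Proof. exact: (@flat_nat _ (OTens (OVar Y) (OVar X)) (OTens (OVar X) (OVar Y))). Qed.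

Lemma pairF_nat W W' (f : W ~> W') : pairF W' ∘ (B ◁ (B ◁ f)) = f ∘ pairF W.
Proof. by rewrite !pairFE -!compA muF_nat (comp_l (epsF_nat _)) -compA. Qed.

Lemma copairF_nat W W' (f : W ~> W') : copairF W' ∘ f = (B ◁ (B ◁ f)) ∘ copairF W.
Proof. by rewrite !copairFE -!compA etaF_nat (comp_l (deltaF_nat _)) -compA. Qed.

Lemma copairiF_nat W W' (f : W ~> W') : copairiF W' ∘ f = (B ◁ (B ◁ f)) ∘ copairiF W.
Proof. by rewrite !copairiFE -!compA copairF_nat (comp_l (swapi_nat _ _ _)) -compA. Qed.

Lemma targetF_nat W W' (f : W ~> W') : targetF W' ∘ (B ◁ f) = (B ◁ f) ∘ targetF W.
Proof.
rewrite !targetFE -!compA (whisk2 _ (copairiF_nat _)) !whiskl_comp.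
by rewrite (comp_l (pairF_nat _)) -compA.
Qed.

Lemma sourceF_nat W W' (f : W ~> W') : sourceF W' ∘ (B ◁ f) = (B ◁ f) ∘ sourceF W.
Proof.
rewrite !sourceFE -!compA copairiF_nat (comp_l (whisk2 _ (pairF_nat _))).
by rewrite whiskl_comp -compA.
Qed.

Lemma phiF_nat W W' (f : W ~> W') : phiF W' ∘ (B ◁ f) = (B ◁ f) ∘ phiF W.
Proof.
rewrite !phiFE -!compA (whisk2 _ (copairF_nat _)) !whiskl_comp.
by rewrite (comp_l (pairF_nat _)) -compA.
Qed.

(* The tactic [nat] brings a composite into a normal form for the interchange law: of two
   independent generators, the one further to the left is applied first. *)
Ltac strip_whisk a f :=
  lazymatch a with
  | OVar _ => lazymatch f with _ ◁ ?h => h end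
  | OUnit _ => f
  | OTens ?b ?c => let f' := strip_whisk b f in strip_whisk c f'
  end.

Ltac push_rule g f :=
  lazymatch g with
  | tensm (idm ?V) ?g' =>
      lazymatch f with
      | tensm (idm _) ?f' => let r := push_rule g' f' in constr:(whisk2 V r)
      end
  | muF _ => lazymatch f with _ ◁ (_ ◁ ?h) => constr:(muF_nat h) end
  | deltaF _ => lazymatch f with _ ◁ ?h => constr:(deltaF_nat h) end
  | etaF _ => constr:(etaF_nat f)
  | epsF _ => lazymatch f with _ ◁ ?h => constr:(epsF_nat h) end
  | @flat ?M ?a ?b ?k _ =>
      let h := strip_whisk a f in
      let r := constr:(@flat_nat M a b k _ _ h) in
      let t := type of r in
      let t' := eval cbn [ofl ofm] in t in constr:(r : t')
  | strandF ?k _ => lazymatch f with _ ◁ ?h => constr:(strand_nat k h) end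
  | pairF _ => lazymatch f with _ ◁ (_ ◁ ?h) => constr:(pairF_nat h) end
  | copairF _ => constr:(copairF_nat f)
  | copairiF _ => constr:(copairiF_nat f)
  | targetF _ => lazymatch f with _ ◁ ?h => constr:(targetF_nat h) end
  | sourceF _ => lazymatch f with _ ◁ ?h => constr:(sourceF_nat h) end
  | phiF _ => lazymatch f with _ ◁ ?h => constr:(phiF_nat h) end
  | swap ?X ?Y _ => lazymatch f with _ ◁ (_ ◁ ?h) => constr:(swap_natr X Y h) end
  | swapi ?X ?Y _ => lazymatch f with _ ◁ (_ ◁ ?h) => constr:(swapi_nat X Y h) end
  end.

Ltac push_step :=
  match goal with
  | |- context [comp ?g (comp ?f _)] =>
      let r := push_rule g f in rewrite (comp_l r)
  | |- context [comp ?g ?f] => let r := push_rule g f in rewrite r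
  end; rewrite ?whiskl_comp -?compA.

Ltac nat := rewrite ?whiskl_comp -?compA; repeat push_step.

(** * The axioms as identities between natural families *)

Lemma muF_assoc W : muF W ∘ muF (B ⊗ W) = muF W ∘ (B ◁ muF W).
Proof. by move: (muA B) => H; flatten_in M W H; fold_fam. Qed.

Lemma muF_unitl W : muF W ∘ etaF (B ⊗ W) = idm (B ⊗ W).
Proof. by move: (mu1m B) => H; flatten_in M W H; fold_fam. Qed.

Lemma muF_unitr W : muF W ∘ (B ◁ etaF W) = idm (B ⊗ W).
Proof. by move: (mum1 B) => H; flatten_in M W H; fold_fam. Qed.

Lemma deltaF_coassoc W : deltaF (B ⊗ W) ∘ deltaF W = (B ◁ deltaF W) ∘ deltaF W.
Proof. by move: (deltaA B) => H; flatten_in M W H; fold_fam. Qed.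

Lemma deltaF_counitl W : epsF (B ⊗ W) ∘ deltaF W = idm (B ⊗ W).
Proof. by move: (delta1m B) => H; flatten_in M W H; fold_fam. Qed.

Lemma deltaF_counitr W : (B ◁ epsF W) ∘ deltaF W = idm (B ⊗ W).
Proof. by move: (deltam1 B) => H; flatten_in M W H; fold_fam. Qed.

Lemma deltaF_muF W : deltaF W ∘ muF W =
  muF (B ⊗ W) ∘ ((B ◁ (B ◁ muF W)) ∘ ((B ◁ swap B B (B ⊗ W))
    ∘ (deltaF (B ⊗ (B ⊗ W)) ∘ (B ◁ deltaF W)))).
Proof. by move: (delta_mu B); rewrite /inner => H; flatten_in M W H; fold_fam. Qed.

Lemma swapK X Y W : swapi X Y W ∘ swap X Y W = idm _.
Proof.
by move: (braidK X Y) => H; flatten_in M W H; fold_fam.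
Qed.

Lemma swapiK X Y W : swap X Y W ∘ swapi X Y W = idm _.
Proof.
by move: (braidiK X Y) => H; flatten_in M W H; fold_fam.
Qed.

Lemma pairF_muF W : pairF W ∘ muF (B ⊗ W) =
  pairF W ∘ (pairF (B ⊗ (B ⊗ W)) ∘ (B ◁ deltaF (B ⊗ W))).
Proof.
move: (eps_mu2 B); rewrite /inner_split => H; flatten_in M W H; fold_fam.
by rewrite ?pairFE ?copairFE; nat.
Qed.

Lemma pairF_muF_braidi W : pairF W ∘ muF (B ⊗ W) =
  pairF W ∘ (pairF (B ⊗ (B ⊗ W)) ∘ ((B ◁ swapi B B (B ⊗ W)) ∘ (B ◁ deltaF (B ⊗ W)))).
Proof.
move: (eps_mu2i B); rewrite /inner_split => H; flatten_in M W H; fold_fam.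
by rewrite ?pairFE ?copairFE; nat.
Qed.

Lemma deltaF_copairF W : deltaF (B ⊗ W) ∘ copairF W =
  (B ◁ muF (B ⊗ W)) ∘ ((B ◁ (B ◁ copairF W)) ∘ copairF W).
Proof.
move: (delta2_eta B); rewrite /inner_merge => H; flatten_in M W H; fold_fam.
by rewrite ?pairFE ?copairFE; nat.
Qed.

Lemma deltaF_copairF_braidi W : deltaF (B ⊗ W) ∘ copairF W =
  (B ◁ muF (B ⊗ W)) ∘ ((B ◁ swapi B B (B ⊗ W)) ∘ ((B ◁ (B ◁ copairF W)) ∘ copairF W)).
Proof.
move: (delta2_etai B); rewrite /inner_merge => H; flatten_in M W H; fold_fam.
by rewrite ?pairFE ?copairFE; nat.
Qed.

(** The second form of axiom (v) with the unit as middle argument: ε(xy) = ε(x 1_2) ε(1_1 y). *)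
Lemma pairF_targetF W : pairF W ∘ targetF (B ⊗ W) = pairF W.
Proof.
rewrite targetFE copairiFE copairFE !whiskl_comp (comp_l4 (esym (pairF_muF_braidi W))).
by rewrite -compA muF_unitr compm1.
Qed.

Lemma targetF_idem W : targetF W ∘ targetF W = targetF W.
Proof.
by rewrite {1}targetFE -compA -targetF_nat (comp_l (pairF_targetF _)) -targetFE.
Qed.

(** By the first form of axiom (w), 1_1 ⊗ 1_2 1'_1 ⊗ 1'_2 is the iterated coproduct of 1; applying ε
    to its middle factor gives back δη. *)
Lemma phiF_copairF W : (B ◁ phiF W) ∘ copairF W = copairF W.
Proof.
rewrite phiFE pairFE !whiskl_comp -!compA -deltaF_copairF.
rewrite {1}copairFE (comp_l (deltaF_coassoc _)) -!compA.
by rewrite (comp_l (whisk2 _ (deltaF_counitl _))) tensm1 comp1m -copairFE.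
Qed.

Lemma copairF_coassoc W : (B ◁ deltaF W) ∘ copairF W = deltaF (B ⊗ W) ∘ copairF W.
Proof. by rewrite copairFE (comp_l (deltaF_coassoc _)) -compA. Qed.

Lemma pairF_assoc W : pairF W ∘ (B ◁ muF W) = pairF W ∘ muF (B ⊗ W).
Proof. by rewrite pairFE -!compA muF_assoc. Qed.

(** Axiom (b) applied to b = 1b; [deltaF_unitr] applies it to b = b1. *)
Lemma deltaF_unitl W : deltaF W =
  muF (B ⊗ W) ∘ ((B ◁ (B ◁ muF W)) ∘ ((B ◁ swap B B (B ⊗ W))
    ∘ (copairF (B ⊗ (B ⊗ W)) ∘ deltaF W))).
Proof.
rewrite -[LHS]compm1 -muF_unitl compA deltaF_muF -!compA -etaF_nat.
by rewrite copairFE -!compA.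
Qed.

Lemma deltaF_unitr W : deltaF W =
  muF (B ⊗ W) ∘ ((B ◁ (B ◁ muF W)) ∘ ((B ◁ swap B B (B ⊗ W))
    ∘ ((B ◁ (B ◁ copairF W)) ∘ deltaF W))).
Proof.
rewrite -{1}[deltaF W]compm1 -muF_unitr compA deltaF_muF -!compA.
rewrite (whisk2 _ (esym (copairFE _))).
by rewrite deltaF_nat.
Qed.

(** Axiom (b) and the counit law: with braidings suppressed, xy = ε(x_1 y_1) x_2 y_2. *)
Lemma muF_counit W :
  muF W = pairF (B ⊗ W) ∘ ((B ◁ (B ◁ muF W)) ∘ ((B ◁ swap B B (B ⊗ W)) ∘
    (deltaF (B ⊗ (B ⊗ W)) ∘ (B ◁ deltaF W)))).
Proof. by rewrite pairFE -!compA -deltaF_muF compA deltaF_counitl comp1m. Qed.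

(* ε(x c_1) c_2 = φ(x) c *)
Lemma pairF_deltaF W : pairF (B ⊗ W) ∘ (B ◁ deltaF W) = muF W ∘ phiF (B ⊗ W).
Proof.
(* Writing δ(c) = δ(1)δ(c), the first form of axiom (v) splits ε(x 1_1 c_1) into ε(x 1_1) ε(1_2
   c_1); what remains, ε(1_2 c_1) 1_3 c_2, is 1_2 c by [muF_counit]. *)
rewrite phiFE {1}deltaF_unitl !whiskl_comp (comp_l (pairF_assoc _)) pairF_muF.
rewrite [in RHS]muF_counit.
nat.
by rewrite (whisk2 _ (esym (copairF_coassoc _))); nat.
Qed.

(** * Sliding generators through crossings *)

Lemma braid_tensrE Z X Y :
  braid Z (X ⊗ Y) = associ X Y Z ∘ ((X ◁ braid Z Y) ∘ swap Z X Y).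
Proof. by rewrite -braid_tensr compA assocK comp1m. Qed.

(** In the [cross] lemmas the final [l] or [r] tells whether the strand carrying the generator
    enters the crossing on the left or on the right. *)
Lemma cross_deltal X W : (X ◁ deltaF W) ∘ swap B X W =
  swap B X (B ⊗ W) ∘ ((B ◁ swap B X W) ∘ deltaF (X ⊗ W)).
Proof.
have := braid_nat (delta B) (idm X); rewrite braid_tensl swapE => H.
by flatten_in M W H; fold_fam.
Qed.

Lemma cross_mul X W : (X ◁ muF W) ∘ (swap B X (B ⊗ W) ∘ (B ◁ swap B X W)) =
  swap B X W ∘ muF (X ⊗ W).
Proof.
have := braid_nat (mu B) (idm X); rewrite braid_tensl swapE => H.
by flatten_in M W H; fold_fam.
Qed.

Lemma cross_mur X W : swap X B W ∘ (X ◁ muF W) =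
  muF (X ⊗ W) ∘ ((B ◁ swap X B W) ∘ swap X B (B ⊗ W)).
Proof.
have := braid_nat (idm X) (mu B); rewrite braid_tensrE swapE => H.
by flatten_in M W H; fold_fam.
Qed.

Lemma cross_epsr X W : epsF (X ⊗ W) ∘ swap X B W = X ◁ epsF W.
Proof.
have := congr1 (comp (lunit X)) (braid_nat (idm X) (eps B)).
rewrite compA lunit_braid => H.
by flatten_in M W H; fold_fam.
Qed.

Lemma cross_epsl X W : (X ◁ epsF W) ∘ swap B X W = epsF (X ⊗ W).
Proof.
have := congr1 (comp (runit X)) (braid_nat (eps B) (idm X)).
rewrite compA runit_braid => H.
by flatten_in M W H; fold_fam.
Qed.

Lemma braid_runiti X : braid X munit ∘ runiti X = luniti X.
Proof.
by rewrite -[LHS]comp1m -(lunitK X) -!compA (comp_l (lunit_braid X)) runitiK compm1.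
Qed.

Lemma cross_etar X W : swap X B W ∘ (X ◁ etaF W) = etaF (X ⊗ W).
Proof.
have := congr1 (comp^~ (runiti X)) (braid_nat (idm X) (eta B)).
rewrite -!compA braid_runiti => H.
by flatten_in M W H; fold_fam.
Qed.

Lemma cross_deltar X W : (B ◁ swap X B W) ∘ (swap X B (B ⊗ W) ∘ (X ◁ deltaF W)) =
  deltaF (X ⊗ W) ∘ swap X B W.
Proof.
have := braid_nat (idm X) (delta B); rewrite braid_tensrE swapE => H.
by flatten_in M W H; fold_fam.
Qed.

(** A mixed Yang-Baxter relation: the strand X passes an inverse crossing, by naturality of the
    braiding. *)
Lemma cross_braidir X W :
  (B ◁ swap X B W) ∘ (swap X B (B ⊗ W) ∘ (X ◁ swapi B B W)) =
  swapi B B (X ⊗ W) ∘ ((B ◁ swap X B W) ∘ swap X B (B ⊗ W)).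
Proof.
have := braid_nat (idm X) (braidi B B); rewrite !braid_tensrE swapE => H.
by flatten_in M W H; fold_fam.
Qed.

Lemma cross_copairr X W :
  (B ◁ swap X B W) ∘ (swap X B (B ⊗ W) ∘ (X ◁ copairF W)) = copairF (X ⊗ W).
Proof.
by rewrite !copairFE whiskl_comp (comp_l3 (cross_deltar _ _)) -compA cross_etar.
Qed.

Lemma cross_pairl X W :
  (X ◁ pairF W) ∘ (swap B X (B ⊗ W) ∘ (B ◁ swap B X W)) = pairF (X ⊗ W).
Proof.
by rewrite !pairFE whiskl_comp -compA cross_mul compA cross_epsl.
Qed.

Lemma cross_pairr X W :
  pairF (X ⊗ W) ∘ ((B ◁ swap X B W) ∘ swap X B (B ⊗ W)) = X ◁ pairF W.
Proof.
by rewrite !pairFE -compA -cross_mur compA cross_epsr whiskl_comp.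
Qed.

Lemma whisk_inv V X Y (f : X ~> Y) g : g ∘ f = idm _ -> (V ◁ g) ∘ (V ◁ f) = idm _.
Proof. by move=> gf; rewrite -whiskl_comp gf tensm1. Qed.

(** The [uncross] lemmas trade a crossing on one side of a [cross] identity for an inverse crossing
    on the other. *)
Lemma uncross_pairl X W :
  pairF (X ⊗ W) ∘ (B ◁ swapi B X W) = (X ◁ pairF W) ∘ swap B X (B ⊗ W).
Proof.
rewrite -cross_pairl -!compA (whisk_inv _ (swapiK _ _ _)) compm1 //.
Qed.

Lemma uncross_mul X W :
  swapi B X W ∘ (X ◁ muF W) =
  muF (X ⊗ W) ∘ ((B ◁ swapi B X W) ∘ swapi B X (B ⊗ W)).
Proof.
apply: (comp_mono (swapK B X W)); rewrite compA swapiK comp1m.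
rewrite compA -cross_mul -!compA (comp_l (whisk_inv _ (swapiK _ _ _))) comp1m.
by rewrite swapiK compm1.
Qed.

Lemma uncross_copair X W :
  swapi X B (B ⊗ W) ∘ ((B ◁ swapi X B W) ∘ copairF (X ⊗ W)) = X ◁ copairF W.
Proof.
rewrite -cross_copairr (comp_l (whisk_inv _ (swapK _ _ _))) comp1m.
by rewrite (comp_l (swapK _ _ _)) comp1m.
Qed.

(* The braided form of ε(b_1 1'_1 1_2) ⊗ 1_1 ⊗ b_2 1'_2, where 1_2 1'_1 has been rewritten by the
   second form of axiom (w): moving b_2 and then the pair 1_1 ⊗ 1_2 through the other strands
   undoes all crossings except that of b_2 with 1'_1. *)
Lemma targetF_deltaF_core W :
  (B ◁ pairF (B ⊗ (B ⊗ W))) ∘ ((B ◁ (B ◁ swap B B (B ⊗ W)))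
    ∘ (swap B B (B ⊗ (B ⊗ (B ⊗ W))) ∘ ((B ◁ swap B B (B ⊗ (B ⊗ W))) ∘ ((B ◁ (B ◁ (B ◁ muF (B ⊗ W))))
    ∘ ((B ◁ (B ◁ (B ◁ swapi B B (B ⊗ W)))) ∘ ((B ◁ (B ◁ (B ◁ (B ◁ copairF W))))
    ∘ (B ◁ (B ◁ copairF W)))))))) =
  targetF (B ⊗ (B ⊗ W)) ∘ (muF (B ⊗ (B ⊗ W))
    ∘ ((B ◁ swap B B (B ⊗ W)) ∘ (B ◁ (B ◁ copairF W)))).
Proof.
have E1 : (B ◁ swap B B (B ⊗ W)) ∘ (swap B B (B ⊗ (B ⊗ W)) ∘ ((B ◁ (B ◁ muF (B ⊗ W)))
    ∘ ((B ◁ (B ◁ swapi B B (B ⊗ W))) ∘ ((B ◁ (B ◁ (B ◁ copairF W))) ∘ (B ◁ copairF W))))) =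
  (B ◁ muF (B ⊗ (B ⊗ W))) ∘ ((B ◁ swapi B B (B ⊗ (B ⊗ W))) ∘
    (copairF (B ⊗ (B ⊗ (B ⊗ W))) ∘ (swap B B (B ⊗ W) ∘ (B ◁ copairF W)))).
  nat.
  rewrite (comp_l (whisk2 _ (cross_mur _ _))) !whiskl_comp -!compA.
  rewrite (comp_l3 (whisk3 _ (cross_braidir _ _))) !whiskl_comp -!compA.
  by rewrite -cross_copairr; nat.
transitivity ((B ◁ pairF (B ⊗ (B ⊗ W))) ∘ (swap B B (B ⊗ (B ⊗ (B ⊗ W))) ∘ (B ◁
 ((B ◁ swap B B (B ⊗ W)) ∘ (swap B B (B ⊗ (B ⊗ W)) ∘ ((B ◁ (B ◁ muF (B ⊗ W)))
    ∘ ((B ◁ (B ◁ swapi B B (B ⊗ W))) ∘ ((B ◁ (B ◁ (B ◁ copairF W))) ∘ (B ◁ copairF W))))))))).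
  by nat.
rewrite E1.
(* The crossing of b_1 with 1_1 becomes an inverse crossing of 1_1 with the product 1'_1 1_2. Once
   the pair has slid past 1'_1 it appears as c^-1 δη, which yields t(b_1 1'_1). *)
rewrite (comp_l (esym (uncross_pairl _ _))) !whiskl_comp -!compA.
rewrite (comp_l (whisk2 _ (uncross_mul _ _))) !whiskl_comp -!compA.
rewrite (comp_l3 (whisk3 _ (uncross_copair _ _))).
rewrite (comp_l (pairF_assoc _)).
by rewrite targetFE copairiFE whiskl_comp -!compA; nat.
Qed.

(* t(b_1) ⊗ b_2 = 1_1 ⊗ b 1_2 *)
Lemma targetF_deltaF W :
  targetF (B ⊗ W) ∘ deltaF W = (B ◁ muF W) ∘ (swap B B (B ⊗ W) ∘ (B ◁ copairF W)).
Proof.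
transitivity ((B ◁ muF W) ∘ (targetF (B ⊗ (B ⊗ W)) ∘ (muF (B ⊗ (B ⊗ W))
    ∘ ((B ◁ swap B B (B ⊗ W)) ∘ ((B ◁ (B ◁ copairF W)) ∘ deltaF W))))).
  by rewrite {1}deltaF_unitr; nat.
(* On the right, b 1_2 becomes ε(b_1 1_2) b_2 1_3 by coassociativity; the second form of axiom (w)
   then rewrites 1_1 ⊗ 1_2 ⊗ 1_3, and both sides are t(b_1 1_1) ⊗ b_2 1_2. *)
rewrite [in RHS]muF_counit; nat.
rewrite (comp_l (cross_deltal _ _)); nat.
have E : (B ◁ (B ◁ (B ◁ deltaF W))) ∘ (swap B B (B ⊗ (B ⊗ W))
    ∘ ((B ◁ swap B B (B ⊗ W)) ∘ ((B ◁ (B ◁ copairF W)) ∘ deltaF W))) =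
  swap B B (B ⊗ (B ⊗ (B ⊗ W))) ∘ ((B ◁ swap B B (B ⊗ (B ⊗ W)))
    ∘ ((B ◁ (B ◁ ((B ◁ deltaF W) ∘ copairF W))) ∘ deltaF W)).
  by nat.
rewrite E copairF_coassoc deltaF_copairF_braidi; congr (_ ∘ _).
transitivity (((B ◁ pairF (B ⊗ (B ⊗ W))) ∘ ((B ◁ (B ◁ swap B B (B ⊗ W)))
    ∘ (swap B B (B ⊗ (B ⊗ (B ⊗ W))) ∘ ((B ◁ swap B B (B ⊗ (B ⊗ W))) ∘ ((B ◁ (B ◁ (B ◁ muF (B ⊗ W))))
    ∘ ((B ◁ (B ◁ (B ◁ swapi B B (B ⊗ W)))) ∘ ((B ◁ (B ◁ (B ◁ (B ◁ copairF W))))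
    ∘ (B ◁ (B ◁ copairF W))))))))) ∘ deltaF W).
  by rewrite targetF_deltaF_core -!compA.
by nat.
Qed.

(* r(b_1) ⊗ b_2 = 1_2 ⊗ φ(1_1) b, with δη braided by c^-1 *)
Lemma sourceF_deltaF W :
  sourceF (B ⊗ W) ∘ deltaF W = (B ◁ (muF W ∘ phiF (B ⊗ W))) ∘ copairiF (B ⊗ W).
Proof.
by rewrite sourceFE -!compA copairiF_nat -pairF_deltaF; nat.
Qed.

(** * The morphisms G f *)

Implicit Types f g : B ~> B.
Notation T := (induced_weak_bimonad B).

Lemma strand_conv f g W :
  strandF (convolution f g) W = muF W ∘ (strandF f (B ⊗ W) ∘ ((B ◁ strandF g W) ∘ deltaF W)).
Proof.
have H : convolution f g = mu B ∘ (f ⊠ g) ∘ delta B by [].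
by flatten_in M W H; fold_fam.
Qed.

Lemma strand_target W : strandF (target_map B) W = targetF W.
Proof.
have H : target_map B = runit B ∘ (B ◁ eps B) ∘ (B ◁ mu B) ∘ assoc B B B ∘ (braid B B ▷ B)
    ∘ associ B B B ∘ (B ◁ delta B) ∘ (B ◁ eta B) ∘ runiti B by [].
flatten_in M W H; fold_fam => ->.
rewrite (comp_l (whisk2 _ (esym (pairFE _)))) (whisk2 _ (esym (copairFE _))).
by rewrite targetFE copairiFE whiskl_comp compA -uncross_pairl -compA.
Qed.

Lemma uncross_pairr X W :
  pairF (X ⊗ W) ∘ (B ◁ swap X B W) = (X ◁ pairF W) ∘ swapi X B (B ⊗ W).
Proof. by rewrite -cross_pairr -!compA swapiK compm1. Qed.

Lemma strand_source W : strandF (source_map B) W = sourceF W.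
Proof.
have H : source_map B = lunit B ∘ (eps B ▷ B) ∘ (mu B ▷ B) ∘ associ B B B ∘ (B ◁ braid B B)
    ∘ assoc B B B ∘ (delta B ▷ B) ∘ (eta B ▷ B) ∘ luniti B by [].
flatten_in M W H; fold_fam => ->.
rewrite (comp_l (esym (pairFE _))) -copairFE.
by rewrite sourceFE copairiFE compA uncross_pairr -compA.
Qed.

(** This is G f with X and Y carried along; the crossing of b_1 with Y is contained in [coact]. *)
Definition gal f X Y : (X ⊗ B) ⊗ (Y ⊗ B) ~> (X ⊗ B) ⊗ (Y ⊗ B) :=
  locked ((tensB_mul B X ▷ (Y ⊗ B)) ∘ associ (X ⊗ B) B (Y ⊗ B)
    ∘ ((X ⊗ B) ◁ ((f ▷ (Y ⊗ B)) ∘ coact B Y))).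

Lemma galE f X Y : gal f X Y = (tensB_mul B X ▷ (Y ⊗ B)) ∘ associ (X ⊗ B) B (Y ⊗ B)
    ∘ ((X ⊗ B) ◁ ((f ▷ (Y ⊗ B)) ∘ coact B Y)).
Proof. by rewrite /gal -lock. Qed.

Notation oXBYB X Y := (OTens (OTens (OVar X) oB) (OTens (OVar Y) oB)).

Lemma gal_flat f X Y W : @flat M (oXBYB X Y) (oXBYB X Y) (gal f X Y) W =
  X ◁ (muF (Y ⊗ (B ⊗ W)) ∘ ((B ◁ strandF f (Y ⊗ (B ⊗ W))) ∘
   ((B ◁ swap Y B (B ⊗ W)) ∘ (B ◁ (Y ◁ deltaF W))))).
Proof.
have H := galE f X Y; rewrite /tensB_mul coactE swapE in H.
by flatten_in M W H; fold_fam.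
Qed.

Lemma gal_conv f g X Y : gal f X Y ∘ gal g X Y = gal (convolution g f) X Y.
Proof.
apply: (@flat_inj M (oXBYB X Y) (oXBYB X Y)) => W.
rewrite gal_flat (@flat_comp M _ (oXBYB X Y)).
rewrite !gal_flat (whisk2 X erefl); congr (X ◁ _).
rewrite strand_conv; nat.
rewrite (comp_l (esym (muF_assoc _))) (comp_l (whisk2 _ (esym (cross_deltar _ _)))).
rewrite !whiskl_comp -!compA (whisk2 _ (whisk2 _ (deltaF_coassoc _))).
by nat.
Qed.

Lemma can_gal X Y : can T X Y = gal (idm B) X Y ∘ assoc (X ⊗ B) Y B.
Proof. by rewrite /can /= tensB_tauE galE tensm1 comp1m !compA. Qed.

Lemma cross_strand_r Z X Y (f : X ~> Y) W :
  swap Z Y W ∘ (Z ◁ strandF f W) = strandF f (Z ⊗ W) ∘ swap Z X W.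
Proof. by rewrite !strandFE swap_natm. Qed.

Lemma cross_strand_l Z X Y (f : X ~> Y) W :
  swap Y Z W ∘ strandF f (Z ⊗ W) = (Z ◁ strandF f W) ∘ swap X Z W.
Proof. by rewrite !strandFE swap_natl. Qed.

(** The unit of the monad inserts δη, so E sends a ⊗ b to a 1_1 ⊗ b 1_2, and this is a t(b_1) ⊗ b_2
    by [targetF_deltaF]. *)
Lemma Eid_gal X Y :
  Eid (T := T) (mT T X) (mT T Y) = gal (target_map B) X Y.
Proof.
have -> : Eid (T := T) (mT T X) (mT T Y) =
    (tensB_mul B X ⊠ tensB_mul B Y) ∘ tensB_tau B (X ⊗ B) (Y ⊗ B)
    ∘ tensB_unit B ((X ⊗ B) ⊗ (Y ⊗ B)) by [].
rewrite tensB_tauE coactE swapE braid_tensl swapE /tensB_mul /tensB_unit.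
apply: (@flat_inj M (oXBYB X Y) (oXBYB X Y)) => W.
rewrite gal_flat; flatten_lhs M.
rewrite (whisk2 _ (whisk2 _ (whisk2 _ (whisk2 _ (esym (copairFE _)))))).
rewrite (comp_l (whisk2 _ (whisk2 _ (esym (cross_strand_r _ _ _))))).
rewrite strand_target !whiskl_comp -!compA (whisk2 _ (whisk2 _ (whisk2 _ (targetF_deltaF _)))).
by nat.
Qed.

(** * The base monoid and the idempotent F *)

Lemma braid_unitl X : braid munit X = runiti X ∘ lunit X.
Proof. by rewrite -(runit_braid X) compA runitK comp1m. Qed.

(** Crossing the unit object is trivial, after which both sides flatten to the same family. Up to K
    ⊗ B ≅ B, the base monoid is therefore a splitting of t. *)
Lemma sqcapE : sqcap T = luniti B ∘ target_map B ∘ lunit B.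
Proof.
have -> : sqcap T = runit (K ⊗ B) ∘ ((K ⊗ B) ◁ (eps B ∘ lunit B))
    ∘ ((K ⊗ B) ◁ tensB_mul B K) ∘ tensB_tau B K (K ⊗ B) ∘ (luniti (K ⊗ B) ▷ B)
    ∘ tensB_unit B (K ⊗ B) by [].
rewrite tensB_tauE coactE swapE braid_tensl swapE braid_unitl /tensB_mul /tensB_unit.
rewrite /target_map.
by flatten (bmcat M) W; fold_fam.
Qed.

Definition phi_map : B ~> B :=
  lunit B ∘ (eps B ▷ B) ∘ (mu B ▷ B) ∘ associ B B B ∘ (B ◁ delta B) ∘ (B ◁ eta B)
    ∘ runiti B.

Lemma strand_phi W : strandF phi_map W = phiF W.
Proof.
rewrite /strandF /phi_map; flatten_lhs (bmcat M).
by rewrite phiFE pairFE copairFE !whiskl_comp -!compA.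
Qed.

Context (S : splitting (sqcap T)).
Notation R := (Defs.R S).

Definition inclB : R ~> B := lunit B ∘ split_incl S.
Definition projB : B ~> R := split_proj S ∘ luniti B.

Lemma inclB_proj : inclB ∘ projB = target_map B.
Proof.
rewrite /inclB /projB -compA (comp_l (split_inclK S)) sqcapE.
by rewrite -!(compA (luniti B)) (comp_l (lunitiK _)) -compA lunitiK comp1m compm1.
Qed.

Lemma actR_E : actR S = projB ∘ mu B ∘ (inclB ▷ B).
Proof.
have -> : actR S = split_proj S ∘ tensB_mul B K ∘ (split_incl S ▷ B) by [].
have -> : split_proj S = projB ∘ lunit B by rewrite /projB -compA lunitK compm1.
have -> : split_incl S = luniti B ∘ inclB by rewrite /inclB compA lunitK comp1m.
rewrite /tensB_mul.
by flatten (bmcat M) W; fold_fam.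
Qed.

Lemma etaR_E : etaR S = projB ∘ eta B.
Proof.
have -> : etaR S = split_proj S ∘ tensB_unit B K by [].
have -> : split_proj S = projB ∘ lunit B by rewrite /projB -compA lunitK compm1.
rewrite /tensB_unit.
by flatten (bmcat M) W; fold_fam.
Qed.

Lemma epsR_E : epsR S = eps B ∘ inclB.
Proof. by rewrite /epsR /inclB compA. Qed.

Lemma pairF_etaF W : pairF W ∘ (B ◁ etaF W) = epsF W.
Proof. by rewrite pairFE -compA muF_unitr compm1. Qed.

Lemma epsF_targetF W : epsF W ∘ targetF W = epsF W.
Proof. by rewrite -pairF_etaF -compA -targetF_nat compA pairF_targetF. Qed.

Lemma targetF_etaF W : targetF W ∘ etaF W = etaF W.
Proof.
rewrite targetFE -compA -etaF_nat compA pairFE -(compA (epsF _)) muF_unitl compm1.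
rewrite copairiFE compA -{1}cross_epsl -(compA (B ◁ _)) swapiK compm1.
by rewrite copairFE compA deltaF_counitr comp1m.
Qed.

Lemma phiF_targetF W : phiF W ∘ targetF W = phiF W.
Proof.
by rewrite phiFE -compA -targetF_nat compA pairF_targetF.
Qed.

Lemma incl_proj W : strandF inclB W ∘ strandF projB W = targetF W.
Proof. by rewrite -strand_comp inclB_proj strand_target. Qed.

(** Since ε t = ε, the projection onto the base monoid disappears under the counit. *)
Lemma eps_actR W :
  epsF W ∘ (strandF inclB W ∘ (strandF projB W ∘ muF W)) = pairF W.
Proof. by rewrite (comp_l (incl_proj _)) (comp_l (epsF_targetF _)) -pairFE. Qed.

Lemma braidi_tens X Y Z :
  braidi (X ⊗ Y) Z = associ X Y Z ∘ (X ◁ braidi Y Z) ∘ assoc X Z Y ∘ (braidi X Z ▷ Y)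
   ∘ associ Z X Y.
Proof.
apply: (comp_mono (braidK _ _)); rewrite braidiK braid_tensl swapE.
flatten (bmcat M) W; fold_fam.
rewrite (comp_l (whisk_inv _ (swapiK _ _ _))) comp1m swapiK //.
Qed.

Lemma uncross_strand Z X Y (f : X ~> Y) W :
  swapi Z Y W ∘ strandF f (Z ⊗ W) = (Z ◁ strandF f W) ∘ swapi Z X W.
Proof.
apply: (comp_mono (swapK Z Y W)).
by rewrite compA swapiK comp1m compA cross_strand_r -compA swapiK compm1.
Qed.

(* The copy of 1_1 crosses A to meet R; equivalently, R crosses A by c^-1 to meet 1_1. *)
Lemma betaE A (a : A ⊗ B ~> A) :
  @beta _ T S A a = a ∘ (A ◁ (phi_map ∘ inclB)) ∘ braidi A R.
Proof.
have -> : @beta _ T S A a = lunit A ∘ (epsR S ▷ A) ∘ ((actR S ⊠ (a : A ⊗ B ~> A))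
   ∘ tensB_tau B R A ∘ tensB_unit B (R ⊗ A)) by [].
rewrite epsR_E actR_E tensB_tauE coactE swapE /tensB_unit.
flatten (bmcat M) W; fold_fam.
(* The factor R contributes ε(r 1_1), while 1_2 acts on A; together they act by φ(r). *)
rewrite (comp_l4 (eps_actR _)) (whisk2 _ (whisk2 _ (esym (copairFE _)))); nat.
by rewrite (comp_l (uncross_pairr _ _)) strand_phi phiFE -uncross_strand; nat.
Qed.

Lemma cross_etal X W : swap B X W ∘ etaF (X ⊗ W) = X ◁ etaF W.
Proof.
have braidu : braid munit X ∘ luniti X = runiti X.
  by rewrite braid_unitl -compA lunitiK compm1.
have := congr1 (comp^~ (luniti X)) (braid_nat (eta B) (idm X)).
rewrite -!compA braidu => H.
by flatten_in (bmcat M) W H; fold_fam.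
Qed.

Lemma cross_etaR X W : swap R X W ∘ (strandF projB (X ⊗ W) ∘ etaF (X ⊗ W)) =
  X ◁ (strandF projB W ∘ etaF W).
Proof.
by rewrite (comp_l (cross_strand_l _ _ _)) -compA cross_etal whiskl_comp.
Qed.

Lemma incl_etaR W : strandF inclB W ∘ (strandF projB W ∘ etaF W) = etaF W.
Proof. by rewrite (comp_l (incl_proj _)) targetF_etaF. Qed.

(** The unit in the right copy of R turns its factor into ε(1_3), and the counit law removes it from
    the iterated coproduct of 1. This reduces the action in λ to [beta]. *)
Lemma varrho_etaR A (a : A ⊗ B ~> A) :
  @varrho _ T S A a ∘ ((R ⊗ A) ◁ etaR S) ∘ runiti (R ⊗ A) = @beta _ T S A a.
Proof.
have -> : @beta _ T S A a = lunit A ∘ (epsR S ▷ A) ∘ ((actR S ⊠ (a : A ⊗ B ~> A))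
   ∘ tensB_tau B R A ∘ tensB_unit B (R ⊗ A)) by [].
have -> : @varrho _ T S A a = runit A ∘ (lunit A ▷ K) ∘ ((epsR S ▷ A) ⊠ epsR S) ∘
   (((actR S ⊠ a) ⊠ actR S) ∘ (tensB_tau B R A ▷ (R ⊗ B) ∘ tensB_tau B (R ⊗ A) R)
    ∘ tensB_unit B ((R ⊗ A) ⊗ R)) by [].
rewrite epsR_E etaR_E actR_E !tensB_tauE !coactE !swapE /tensB_unit.
flatten (bmcat M) W; fold_fam.
have E X (h : X ~> B ⊗ (A ⊗ W)) : (B ◁ (A ◁ swap R B (B ⊗ W))) ∘ ((B ◁ (A ◁ (R ◁ deltaF W)))
    ∘ ((B ◁ (A ◁ (R ◁ etaF W))) ∘ ((B ◁ (A ◁ strandF projB W))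
    ∘ ((B ◁ (A ◁ etaF W)) ∘ h)))) =
  (B ◁ (A ◁ ((B ◁ (strandF projB (B ⊗ W) ∘ etaF (B ⊗ W))) ∘ copairF W))) ∘ h.
  by rewrite -cross_etaR copairFE; nat.
nat; rewrite E; nat.
have e_act : epsF W ∘ (strandF inclB W ∘ (strandF projB W ∘ (muF W ∘
    (strandF inclB (B ⊗ W) ∘ (strandF projB (B ⊗ W) ∘ etaF (B ⊗ W)))))) = epsF W.
  by rewrite (comp_l4 (eps_actR _)) incl_etaR pairFE -compA muF_unitl compm1.
transitivity (@flat M (OTens (OVar A) oB) (OVar A) a W ∘ (epsF (A ⊗ (B ⊗ W)) ∘
    (strandF inclB (A ⊗ (B ⊗ W)) ∘ (strandF projB (A ⊗ (B ⊗ W))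
    ∘ (muF (A ⊗ (B ⊗ W)) ∘ ((B ◁ swap A B (B ⊗ W))
    ∘ ((B ◁ (A ◁ deltaF W)) ∘ ((B ◁ (A ◁ ((B ◁ (epsF W ∘ (strandF inclB W ∘
      (strandF projB W ∘ (muF W ∘ (strandF inclB (B ⊗ W) ∘
      (strandF projB (B ⊗ W) ∘ etaF (B ⊗ W)))))))) ∘ copairF W)))
    ∘ strandF inclB (A ⊗ W))))))))).
  by nat.
by rewrite e_act copairFE (comp_l (deltaF_counitr _)) comp1m; nat.
Qed.

(** Both units of R are sent to 1 by [inclB], so E leaves only the two legs of δη, each projected to
    R. *)
Lemma deltaR_etaR : deltaR S ∘ etaR S = (projB ⊠ projB) ∘ delta B ∘ eta B.
Proof.
have -> : deltaR S = ((actR S ⊠ actR S) ∘ tensB_tau B R R ∘ tensB_unit B (R ⊗ R))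
  ∘ (R ◁ etaR S) ∘ runiti R by [].
rewrite etaR_E actR_E !tensB_tauE !coactE !swapE /tensB_unit.
flatten (bmcat M) W; fold_fam.
have E : (swap R B (B ⊗ W)) ∘ ((R ◁ deltaF W)
    ∘ ((R ◁ etaF W) ∘ ((strandF projB W) ∘ etaF W))) =
  (B ◁ (strandF projB (B ⊗ W) ∘ etaF (B ⊗ W))) ∘ copairF W.
  by rewrite -cross_etaR copairFE; nat.
nat; rewrite incl_etaR.
transitivity ((R ◁ strandF projB W) ∘ ((R ◁ muF W) ∘ ((R ◁ strandF inclB (B ⊗ W)) ∘
  (strandF projB (R ⊗ (B ⊗ W)) ∘ (muF (R ⊗ (B ⊗ W)) ∘ (etaF (B ⊗ (R ⊗ (B ⊗ W)))
  ∘ (swap R B (B ⊗ W) ∘ ((R ◁ deltaF W) ∘ ((R ◁ etaF W) ∘ (strandF projB W ∘ etaF W)))))))))).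
  by nat.
rewrite E (comp_l (muF_unitl _)) comp1m copairFE; nat.
rewrite (comp_l3 (whisk3 _ (incl_etaR _))) (comp_l (whisk2 _ (muF_unitl _))).
by rewrite tensm1 comp1m.
Qed.

(** Pure interchange and coherence: the unit h on the far right may be inserted last. Arbitrary
    morphisms stand for the constituents of F so that flattening treats them as generators. *)
Lemma whisk_unit_factor (R A X Y V C : M) (w : A ⊗ V ~> C) (v : (R ⊗ A) ⊗ R ~> A)
    (u : X ⊗ Y ~> A) (b : R ⊗ X ~> X) (d : K ~> R ⊗ R) (h : K ~> R) :
  w ∘ (v ▷ V) ∘ (((R ◁ u) ▷ R) ▷ V) ∘ (((R ◁ ((b ▷ Y) ∘ associ R X Y)) ▷ R) ▷ V)
    ∘ ((assoc R R (X ⊗ Y) ▷ R) ▷ V) ∘ (((d ▷ (X ⊗ Y)) ⊠ h) ▷ V)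
    ∘ ((runiti (K ⊗ (X ⊗ Y)) ∘ luniti (X ⊗ Y)) ▷ V) =
  w ∘ ((v ∘ ((R ⊗ A) ◁ h) ∘ runiti (R ⊗ A) ∘ (R ◁ u)
    ∘ (R ◁ ((b ▷ Y) ∘ associ R X Y)) ∘ assoc R R (X ⊗ Y) ∘ (d ▷ (X ⊗ Y))
    ∘ luniti (X ⊗ Y)) ▷ V).
Proof.
rewrite -!compA -!whiskr_comp; congr (_ ∘ (_ ▷ V)).
by flatten (bmcat M) W; fold_fam; nat.
Qed.

Lemma Fid_E X Y (Z := (X ⊗ B) ⊗ Y) :
  @Fid _ T S X Y = tensB_mul B Z ∘ ((@beta _ T S (Z ⊗ B) (tensB_mul B Z)
    ∘ (R ◁ tensB_unit B Z)
    ∘ (R ◁ ((@beta _ T S (X ⊗ B) (tensB_mul B X) ▷ Y) ∘ associ R (X ⊗ B) Y))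
    ∘ assoc R R Z ∘ ((deltaR S ∘ etaR S) ▷ Z) ∘ luniti Z) ▷ B).
Proof.
by rewrite -(@varrho_etaR (Z ⊗ B)) -whisk_unit_factor.
Qed.

Lemma braidi_nat (X X' Y Y' : M) (f : X ~> X') (g : Y ~> Y') :
  braidi X' Y' ∘ (g ⊠ f) = (f ⊠ g) ∘ braidi X Y.
Proof.
apply: (comp_mono (braidK _ _)).
by rewrite !compA braidiK comp1m braid_nat -compA braidiK compm1.
Qed.

Lemma beta_braidi A (a : A ⊗ B ~> A) :
  @beta _ T S A a = a ∘ braidi A B ∘ ((phi_map ∘ inclB) ▷ A).
Proof. by rewrite betaE -!compA braidi_nat. Qed.

Lemma uncross_eta X W : swapi B X W ∘ (X ◁ etaF W) = etaF (X ⊗ W).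
Proof. by rewrite -cross_etal compA swapK comp1m. Qed.

Lemma phi_incl_proj W : strandF phi_map W ∘ (strandF inclB W ∘ strandF projB W) = phiF W.
Proof. by rewrite incl_proj strand_phi phiF_targetF. Qed.

Lemma cross_copairir X W :
  (B ◁ swap X B W) ∘ (swap X B (B ⊗ W) ∘ (X ◁ copairiF W)) = copairiF (X ⊗ W).
Proof.
by rewrite !copairiFE whiskl_comp (comp_l3 (cross_braidir _ _)) -!compA cross_copairr.
Qed.

Lemma uncross_phi X W : swapi X B W ∘ phiF (X ⊗ W) = (X ◁ phiF W) ∘ swapi X B W.
Proof. by rewrite -!strand_phi uncross_strand. Qed.

Lemma uncross_phi_copair X W :
  swapi X B (B ⊗ W) ∘ ((B ◁ swapi X B W) ∘ (phiF (B ⊗ (X ⊗ W)) ∘ copairF (X ⊗ W))) =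
  X ◁ (phiF (B ⊗ W) ∘ copairF W).
Proof.
rewrite (comp_l (esym (phiF_nat _))) -!compA (comp_l (uncross_phi _ _)) -!compA.
by rewrite uncross_copair whiskl_comp.
Qed.

Lemma uncross_copairi X W :
  swap X B (B ⊗ W) ∘ (X ◁ copairiF W) = (B ◁ swapi X B W) ∘ copairiF (X ⊗ W).
Proof. by rewrite -cross_copairir (comp_l (whisk_inv _ (swapK _ _ _))) comp1m. Qed.

(** In elements, F sends b ⊗ y ⊗ b' to b 1_2 ⊗ y ⊗ φ(1_1) b'. By [betaE] the two legs of δη act
    through φ, the projections being absorbed by φ t = φ, and [phiF_copairF] removes φ from the
    second leg. *)
Lemma Fid_flat X Y W :
  @flat M (OTens (OTens (OTens (OVar X) oB) (OVar Y)) oB)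
     (OTens (OTens (OTens (OVar X) oB) (OVar Y)) oB)
   (@Fid _ T S X Y) W =
   X ◁ ((B ◁ (Y ◁ muF W)) ∘ ((B ◁ swapi Y B (B ⊗ W)) ∘ (muF (B ⊗ (Y ⊗ (B ⊗ W))) ∘
     ((B ◁ (B ◁ phiF (Y ⊗ (B ⊗ W)))) ∘ (B ◁ copairiF (Y ⊗ (B ⊗ W))))))).
Proof.
rewrite Fid_E !beta_braidi deltaR_etaR !braidi_tens /tensB_mul /tensB_unit.
flatten_lhs (bmcat M); nat.
rewrite (comp_l3 (phi_incl_proj _)).
rewrite (comp_l3 (whisk3 _ (phi_incl_proj _))) -copairFE.
rewrite (comp_l (esym (phiF_nat _))) -!compA phiF_copairF.
rewrite uncross_phi_copair.
rewrite (comp_l (whisk2 _ (whisk2 _ (whisk2 _ (uncross_eta _ _))))).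
rewrite (comp_l (whisk2 _ (whisk2 _ (whisk2 _ (muF_unitl _))))) !tensm1 comp1m.
rewrite (comp_l (whisk2 _ (uncross_mul _ _))) !whiskl_comp -!compA.
rewrite -!whiskl_comp; congr (X ◁ (_ ∘ (_ ∘ _))).
by rewrite uncross_phi_copair whiskl_comp (comp_l (whisk2 _ (uncross_phi _ _)))
  copairiFE; nat.
Qed.

(** The formula for F in [Fid_flat] meets that for r(b_1) ⊗ b_2 in [sourceF_deltaF]; what is left is
    to move the crossings with Y. *)
Lemma Fid_gal X Y :
  @Fid _ T S X Y =
  associ (X ⊗ B) Y B ∘ gal (source_map B) X Y ∘ assoc (X ⊗ B) Y B.
Proof.
apply: (@flat_inj M (OTens (OTens (OTens (OVar X) oB) (OVar Y)) oB)
     (OTens (OTens (OTens (OVar X) oB) (OVar Y)) oB)) => W.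
rewrite Fid_flat; symmetry.
rewrite galE coactE swapE /tensB_mul; flatten_lhs (bmcat M).
rewrite (comp_l (whisk2 _ (whisk2 _ (esym (cross_strand_r _ _ _))))) strand_source.
rewrite !whiskl_comp -!compA (whisk2 _ (whisk2 _ (whisk2 _ (sourceF_deltaF _)))); nat.
rewrite (whisk2 _ (whisk2 _ (uncross_copairi _ _))) !whiskl_comp.
by rewrite (comp_l (whisk2 _ (whisk2 _ (uncross_phi _ _)))); nat.
Qed.

(** * Recovering the antipode *)

Lemma conv_assoc f g h :
  convolution (convolution f g) h = convolution f (convolution g h).
Proof.
apply: (@flat_inj M oB oB) => W; rewrite -!/(strandF _ _) !strand_conv; nat.
by rewrite (comp_l (esym (muF_assoc _))) deltaF_coassoc; nat.
Qed.

Lemma target_idem : target_map B ∘ target_map B = target_map B.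
Proof.
apply: (@flat_inj M oB oB) => W; rewrite -!/(strandF _ _) strand_comp strand_target.
exact: targetF_idem.
Qed.

(** With Cauchy completeness this provides the splitting required when χ is built from ν. *)
Lemma sqcap_idem : sqcap T ∘ sqcap T = sqcap T.
Proof.
rewrite sqcapE; move: (target_map B) target_idem => t tt.
by rewrite -!compA (comp_l (lunitiK _)) comp1m (comp_l tt).
Qed.

Lemma gal_nat f (X X' Y Y' : M) (x : X ~> X') (y : Y ~> Y') :
  gal f X' Y' ∘ ((x ▷ B) ⊠ (y ▷ B)) = ((x ▷ B) ⊠ (y ▷ B)) ∘ gal f X Y.
Proof.
rewrite !galE !coactE !swapE /tensB_mul.
flatten (bmcat M) W; fold_fam; nat.
rewrite (comp_l (whisk2 _ (whisk2 _ (esym (strand_nat y (deltaF W)))))) !whiskl_comp -!compA.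
by rewrite (comp_l (whisk2 _ (whisk2 _ (cross_strand_l _ _ _)))); nat.
Qed.

Definition galB f : B ⊗ B ~> B ⊗ B :=
  (mu B ▷ B) ∘ associ B B B ∘ (B ◁ ((f ▷ B) ∘ delta B)).

Lemma galB_flat f W :
  @flat M oBB oBB (galB f) W = muF (B ⊗ W) ∘ ((B ◁ strandF f (B ⊗ W)) ∘ (B ◁ deltaF W)).
Proof. by rewrite /galB; flatten_lhs (bmcat M). Qed.

Lemma galB_gal f :
  galB f = (lunit B ⊠ lunit B) ∘ gal f K K ∘ (luniti B ⊠ luniti B).
Proof.
rewrite /galB galE coactE swapE /tensB_mul braid_unitl.
by flatten (bmcat M) W; fold_fam.
Qed.

Lemma galB_conv f g : galB f ∘ galB g = galB (convolution g f).
Proof.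
have liK : (luniti B ⊠ luniti B) ∘ (lunit B ⊠ lunit B) = idm _.
  by rewrite -tensmM !lunitK tensm1.
by rewrite !galB_gal -gal_conv -!compA (comp_l liK) comp1m.
Qed.

Lemma galB_inj f g : galB f = galB g -> f = g.
Proof.
move=> fg; apply: (@flat_inj M oB oB) => W; rewrite -!/(strandF _ _).
have galK k : strandF k W = (B ◁ epsF W) ∘ (@flat M oBB oBB (galB k) W ∘ etaF (B ⊗ W)).
  rewrite galB_flat -!compA -etaF_nat (comp_l (esym (etaF_nat _))) -compA.
  rewrite (comp_l (muF_unitl _)) comp1m (comp_l (esym (strand_nat _ _))) -compA.
  by rewrite deltaF_counitr compm1.
by rewrite galK fg -galK.
Qed.

(* An h with these properties is unique, so it inherits left linearity and right
   colinearity from the [galB f]. *)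
Lemma galB_inverse (h : B ⊗ B ~> B ⊗ B) :
  h ∘ galB (target_map B) = h -> galB (source_map B) ∘ h = h ->
  h ∘ galB (idm B) = galB (source_map B) -> galB (idm B) ∘ h = galB (target_map B) ->
  exists nu, h = galB nu.
Proof.
move=> ht rh hi ih.
pose G f W := @flat M oBB oBB (galB f) W.
pose H W := @flat M oBB oBB h W.
have Glin f W : G f W ∘ muF (B ⊗ W) = muF (B ⊗ W) ∘ (B ◁ G f W).
  by rewrite /G galB_flat; nat; rewrite (comp_l (esym (muF_assoc _))); nat.
have Gcol f W : G f (B ⊗ W) ∘ (B ◁ deltaF W) = (B ◁ deltaF W) ∘ G f W.
  by rewrite /G !galB_flat; nat; rewrite (whisk2 _ (deltaF_coassoc _)); nat.
have HT W : H W ∘ G (target_map B) W = H W by rewrite /H /G -flat_comp ht.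
have RH W : G (source_map B) W ∘ H W = H W by rewrite /H /G -flat_comp rh.
have HI W : H W ∘ G (idm B) W = G (source_map B) W by rewrite /H /G -flat_comp hi.
have IH W : G (idm B) W ∘ H W = G (target_map B) W by rewrite /H /G -flat_comp ih.
(* Writing t, r for G t, G r and i for G id, left linearity follows from h(xz) = h t(xz) = h(x·i h
   z) = h i(x·h z) = r(x·h z) = x·r h z = x·h z. *)
have Hlin W : H W ∘ muF (B ⊗ W) = muF (B ⊗ W) ∘ (B ◁ H W).
  rewrite -{1}HT -compA Glin -IH whiskl_comp (comp_l (esym (Glin _ _))) -!compA.
  by rewrite (comp_l (HI _)) (comp_l (Glin _ _)) -compA -whiskl_comp RH.
have Hcol W : H (B ⊗ W) ∘ (B ◁ deltaF W) = (B ◁ deltaF W) ∘ H W.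
  rewrite -[in RHS]RH compA -Gcol -HI -!compA (comp_l (Gcol _ _)) -compA IH.
  by rewrite -Gcol compA HT.
(* For h = G ν, evaluating at 1 ⊗ b and applying ε on the right returns ν(b). *)
pose nu := runit B ∘ (B ◁ eps B) ∘ h ∘ (eta B ▷ B) ∘ luniti B.
have nuE W : strandF nu W = (B ◁ epsF W) ∘ (H W ∘ etaF (B ⊗ W)).
  by rewrite /strandF /nu; flatten_lhs (bmcat M).
exists nu; apply: (@flat_inj M oBB oBB) => W; rewrite galB_flat nuE -/(H W).
(* Linearity absorbs the factor a into h, colinearity moves δ behind h, and then the unit and counit
   cancel. *)
rewrite !whiskl_comp -!compA (comp_l (muF_nat _)) -!compA (comp_l (esym (Hlin _))).
rewrite -!compA (comp_l (muF_unitr _)) comp1m Hcol (comp_l (whisk2 _ (deltaF_counitl _))).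
by rewrite tensm1 comp1m.
Qed.

End WeakBimonoid.

(** * The equivalence of the two Hopf conditions *)

Theorem theorem4p6 (M : braided_category) (HM : cauchy_complete M)
    (B : weak_bimonoid M) :
  weak_right_hopf_monad (induced_weak_bimonad B) <-> weak_hopf_monoid B.
Proof.
split=> [[S [chi [_ /(_ munit munit) [chiE [Fchi [chi_can can_chi]]]]]] | [nu [nut [nur nuK]]]].
(* The antipode is read off from χ at X = Y = K; [l] and [li] identify (K ⊗ B) ⊗ (K ⊗ B) with B ⊗
   B. *)
- pose l := lunit B ⊠ lunit B; pose li := luniti B ⊠ luniti B.
  have lK : li ∘ l = idm _ by rewrite -tensmM !lunitK tensm1.
  have conj (x y : (munit ⊗ B) ⊗ (munit ⊗ B) ~> (munit ⊗ B) ⊗ (munit ⊗ B)) :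
      (l ∘ x ∘ li) ∘ (l ∘ y ∘ li) = l ∘ (x ∘ y) ∘ li.
    by rewrite -!compA (comp_l lK) comp1m.
  have galBE f : galB f = l ∘ gal f munit munit ∘ li by exact: galB_gal.
  rewrite Eid_gal in chiE can_chi; rewrite Fid_gal in Fchi chi_can.
  rewrite can_gal in chi_can can_chi.
  (* Absorbing the associator into χ turns [can] into G id and F into G r. *)
  pose g := assoc (munit ⊗ B) munit B ∘ chi munit munit.
  have gt : g ∘ gal (target_map B) munit munit = g by rewrite /g -compA chiE.
  have rg : gal (source_map B) munit munit ∘ g = g.
    by rewrite /g -[in RHS]Fchi !compA associK comp1m.
  have gi : g ∘ gal (idm B) munit munit = gal (source_map B) munit munit.
    apply: (comp_epi (associK (munit ⊗ B) munit B)).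
    have := congr1 (comp (assoc (munit ⊗ B) munit B)) chi_can; rewrite /g.
    move: (gal (idm B) _ _) (gal (source_map B) _ _) => x y.
    by rewrite !compA associK comp1m.
  have ig : gal (idm B) munit munit ∘ g = gal (target_map B) munit munit.
    by rewrite /g compA.
  have [nu nuE] : exists nu, l ∘ g ∘ li = galB nu.
    by apply: galB_inverse; rewrite !galBE conj ?gt ?rg ?gi ?ig.
  exists nu; have nut : convolution nu (idm B) = target_map B.
    by apply: galB_inj; rewrite -galB_conv -nuE !galBE conj ig.
  split=> //; split.
    by apply: galB_inj; rewrite -galB_conv -nuE !galBE conj gi.
  (* By [nut] the claim is t ∗ ν = ν, that is G ν ∘ G t = G ν, which is [gt]. *)
  by apply: galB_inj; rewrite -galB_conv nut -nuE !galBE conj gt.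
- have [S] := HM _ _ (sqcap_idem B).
  (* As [can] is G id after the associator, its weak inverse is G ν followed by the inverse
     associator. *)
  exists S, (fun X Y => associ (X ⊗ B) Y B ∘ gal nu X Y); split=> [X X' Y Y' f g|X Y].
    rewrite -compA gal_nat compA.
    have /associ_flip -> := assoc_nat (f ▷ B) g (idm B).
    by rewrite compA.
  have gal_assoc f g : associ (X ⊗ B) Y B ∘ gal f X Y ∘ assoc (X ⊗ B) Y B
      ∘ (associ (X ⊗ B) Y B ∘ gal g X Y) = associ (X ⊗ B) Y B ∘ gal (convolution g f) X Y.
    by rewrite -gal_conv -!compA (comp_l (associK _ _ _)) comp1m.
  rewrite Eid_gal Fid_gal can_gal gal_assoc -nut -nur.
  split; last split; last split.
  + by rewrite -compA gal_conv nuK.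
  + by rewrite -conv_assoc nuK.
  + by rewrite compA -(compA _ (gal nu X Y)) gal_conv.
  + by rewrite -compA (comp_l (associK _ _ _)) comp1m gal_conv.
Qed.
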